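(* Let $k\ge1$ be an integer, $\lambda_1,\lambda_2>0$, $\delta>0$ and $\gamma>0$. Let $\{Y(t)\}_{t\ge0}$ be the inverse Gaussian subordinator with parameters $\delta,\gamma$, independent of the Skellam process of order $k$, $\{S^{k}(t)\}_{t\ge0}$, with parameters $\lambda_1,\lambda_2$. Then the probability mass function $p^{f_{3}}(n,t)=\mathrm{Pr}\{S^{k}(Y(t))=n\}$, $n\in\mathbb{Z}$, solves the following differential equation: $$\left(\frac{\mathrm{d}^2}{\mathrm{d}t^2}-2\delta \gamma \frac{\mathrm{d}}{\mathrm{d}t}\right) p^{f_{3}}(n,t)=2\delta^2\left(k(\lambda_{1}+\lambda_{2})p^{f_{3}}(n,t)-\lambda_{1}\sum_{j=1}^{k}p^{f_{3}}(n-j,t)-\lambda_{2}\sum_{j=1}^{k}p^{f_{3}}(n+j,t)\right).$$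
   Context: Poisson process of order $k$ (PPoK) with intensity $\lambda>0$: $N^k(t)=\sum_{i=1}^{N(t)}X_i$, where $\{N(t)\}_{t\ge0}$ is a Poisson process with intensity $k\lambda$, and $\{X_i\}_{i\ge1}$ are iid, uniform on $\{1,2,\dots,k\}$, and independent of $\{N(t)\}_{t\ge0}$. Skellam process of order $k$ (SPoK): $S^k(t)=N_1^k(t)-N_2^k(t)$, where $\{N_1^k(t)\}_{t\ge0}$ and $\{N_2^k(t)\}_{t\ge0}$ are independent PPoK with intensities $\lambda_1>0$ and $\lambda_2>0$, respectively. Inverse Gaussian (IG) subordinator: the subordinator $\{Y(t)\}_{t\ge0}$ with probability density function $q(x,t)=(2\pi)^{-1/2}\delta t x^{-3/2}e^{\delta\gamma t-\frac{1}{2}(\delta^{2}t^{2}x^{-1}+\gamma^{2}x)}$, $x>0$, and Bernstein function $f_{3}(s)=\delta\left(\sqrt{2s+\gamma^2}-\gamma\right)$, $s>0$, i.e. $\mathbb{E}(e^{-sY(t)})=e^{-tf_3(s)}$. *)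

(* Defs.v *)
From HB Require Import structures.
From mathcomp Require Import all_boot all_order all_algebra finmap.
From mathcomp Require Import all_classical all_reals all_analysis.

Set Implicit Arguments.
Unset Strict Implicit.
Unset Printing Implicit Defensive.

Import Order.TTheory GRing.Theory Num.Theory.
Import numFieldNormedType.Exports.

Local Open Scope classical_set_scope.
Local Open Scope ring_scope.

HB.instance Definition _ := isPointed.Build int 0.

HB.instance Definition _ := @isMeasurable.Build default_measure_display
  int discrete_measurable discrete_measurable0
  discrete_measurableC discrete_measurableU.

Section independence.
Context {d : measure_display} {T : measurableType d} {R : realType}.
Variable P : probability T R.

Definition mutually_independent {d' : measure_display} {E : measurableType d'}
    {I : choiceType} (X : I -> T -> E) : Prop :=
  forall (J : {fset I}) (A : I -> set E), (forall i, measurable (A i)) ->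
    P (\bigcap_(i in [set` J]) (X i @^-1` A i)) =
    (\prod_(i <- J) P (X i @^-1` A i))%E.

Definition generated_sigma_algebra {d' : measure_display}
    {E : measurableType d'} {I : Type} (D : set I) (X : I -> T -> E) :
    set (set T) :=
  <<s \bigcup_(i in D) preimage_set_system setT (X i) measurable >>.

Definition independent_sigma_algebras (F G : set (set T)) : Prop :=
  forall A B, F A -> G B -> P (A `&` B) = (P A * P B)%E.

End independence.

(* Processes are functions of a real time of which only the values at times
   t >= 0 are constrained or used. *)
Definition nonneg_times {R : realType} : set R := [set t | 0 <= t].

Section processes.
Context {d : measure_display} {T : measurableType d} {R : realType}.
Variable P : probability T R.

Definition independent_processes {d1 d2 : measure_display}
    {E1 : measurableType d1} {E2 : measurableType d2}
    (X : R -> T -> E1) (Y : R -> T -> E2) : Prop :=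
  independent_sigma_algebras P
    (generated_sigma_algebra nonneg_times X)
    (generated_sigma_algebra nonneg_times Y).

(* A finite sequence of times t 0 <= ... <= t m extends to a nondecreasing
   infinite one, and mutual independence only involves finite subfamilies. *)
Definition independent_increments (Z : R -> T -> R) : Prop :=
  forall t : nat -> R, 0 <= t 0%N -> nondecreasing_seq t ->
    mutually_independent P (fun (i : nat) w => Z (t i.+1) w - Z (t i) w).

(* Path properties hold surely, not only almost surely, as for a counting
   process; this makes the events {S(Y(t)) = n} below measurable. *)
Record poisson_process (lambda : R) (N : R -> T -> nat) : Prop := {
  poisson_process_measurable : forall t : R, 0 <= t -> measurable_fun setT (N t) ;
  poisson_process0 : forall w, N 0 w = 0%N ;
  poisson_process_nondecreasing :
    forall w (s t : R), 0 <= s -> s <= t -> (N s w <= N t w)%N ;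
  poisson_process_right_continuous :
    forall w (t : R), 0 <= t -> N s w @[s --> t^'+] --> N t w ;
  poisson_process_independent_increments :
    independent_increments (fun t w => (N t w)%:R) ;
  poisson_process_law : forall (s t : R) (j : nat), 0 <= s -> s < t ->
    P [set w | (N t w - N s w)%N = j] =
    (poisson_pmf (lambda * (t - s)) j)%:E }.

(* The summand X_i with i >= 1 is X i.-1 here. *)
Definition poisson_process_order (k : nat) (lambda : R) (Nk : R -> T -> nat) :
    Prop :=
  exists (N : R -> T -> nat) (X : nat -> T -> nat),
    [/\ poisson_process (k%:R * lambda) N,
        (forall i, measurable_fun setT (X i)) /\
        (forall i j, (1 <= j <= k)%N -> P (X i @^-1` [set j]) = (k%:R^-1)%:E),
        mutually_independent P X,
        independent_sigma_algebras P
          (generated_sigma_algebra nonneg_times N)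
          (generated_sigma_algebra setT X) &
        forall (t : R) w, 0 <= t -> Nk t w = (\sum_(i < N t w) X i w)%N].

Definition skellam_process_order (k : nat) (lambda1 lambda2 : R)
    (S : R -> T -> int) : Prop :=
  exists N1 N2 : R -> T -> nat,
    [/\ poisson_process_order k lambda1 N1,
        poisson_process_order k lambda2 N2,
        independent_processes N1 N2 &
        forall (t : R) w, 0 <= t -> S t w = (N1 t w)%:Z - (N2 t w)%:Z].

(* Nondecreasing Levy process; the remark on the paths of a Poisson process
   applies here too. *)
Record subordinator (Y : R -> T -> R) : Prop := {
  subordinator_measurable : forall t : R, 0 <= t -> measurable_fun setT (Y t) ;
  subordinator0 : forall w, Y 0 w = 0 ;
  subordinator_nondecreasing :
    forall w (s t : R), 0 <= s -> s <= t -> Y s w <= Y t w ;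
  subordinator_right_continuous :
    forall w (t : R), 0 <= t -> Y s w @[s --> t^'+] --> Y t w ;
  subordinator_independent_increments : independent_increments Y ;
  subordinator_stationary_increments :
    forall (s t : R) (A : set R), 0 <= s -> 0 <= t -> measurable A ->
      P [set w | A (Y (s + t) w - Y s w)] = P (Y t @^-1` A) }.

Definition ig_density (delta gamma x t : R) : R :=
  (2 * pi) `^ (- (1 / 2)) * delta * t * x `^ (- (3 / 2)) *
  expR (delta * gamma * t
        - 1 / 2 * (delta ^+ 2 * t ^+ 2 * x^-1 + gamma ^+ 2 * x)).

Definition ig_bernstein (delta gamma s : R) : R :=
  delta * (Num.sqrt (2 * s + gamma ^+ 2) - gamma).

(* Each of the last two conditions implies the other. *)
Record ig_subordinator (delta gamma : R) (Y : R -> T -> R) : Prop := {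
  ig_subordinator_subordinator : subordinator Y ;
  ig_subordinator_density : forall (t : R) (A : set R), 0 < t -> measurable A ->
    P (Y t @^-1` A) =
    (\int[lebesgue_measure]_(x in A `&` `]0%R, +oo[)
       (ig_density delta gamma x t)%:E)%E ;
  ig_subordinator_laplace : forall s t : R, 0 < s -> 0 <= t ->
    'E_P[fun w => expR (- s * Y t w)]%E =
    (expR (- t * ig_bernstein delta gamma s))%:E }.

Definition subordinated_pmf (S : R -> T -> int) (Y : R -> T -> R)
    (n : int) (t : R) : R :=
  fine (P [set w | S (Y t w) w = n]).

End processes.

(* Main.v *)
Require Import Defs.
From HB Require Import structures.
From mathcomp Require Import all_boot all_order all_algebra finmap.
From mathcomp Require Import all_classical all_reals all_analysis.
From mathcomp Require Import measurable_realfun ring lra zify.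

Set Implicit Arguments.
Unset Strict Implicit.
Unset Printing Implicit Defensive.

Import Order.TTheory GRing.Theory Num.Theory.
Import numFieldNormedType.Exports.

Local Open Scope classical_set_scope.
Local Open Scope ring_scope.

(** Write q(n, x) = Pr{S(x) = n} and let g(x, t) be the inverse Gaussian
    density.  Since Y is independent of S, the mass function is the mixture
      p(n, t) = int_0^oo q(n, x) g(x, t) dx   ([subordinated_pmf_integral]),
    and the theorem combines two differential equations.

    The density satisfies g_tt - 2 delta gamma g_t = 2 delta^2 g_x
    ([ig_density_pde]).  This is the time domain form of the identity
    f^2 + 2 delta gamma f = 2 delta^2 s for the Bernstein function f: the
    Laplace transform exp(- t f(s)) solves u'' - 2 delta gamma u' =
    2 delta^2 s u, and multiplication by s corresponds to d/dx.  The
    Skellam probabilities satisfy the forward equation q' = L q, where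
    L q(n) = lambda1 sum_l q(n - l) + lambda2 sum_l q(n + l)
             - k (lambda1 + lambda2) q(n)
    ([skellam_generator]).  Differentiating twice in t under the integral sign
    ([ig_weighted_derivatives]) and integrating by parts in x gives
      p_tt - 2 delta gamma p_t = 2 delta^2 int q g_x = - 2 delta^2 int (L q) g
                               = - 2 delta^2 L p,
    the boundary terms being zero because g vanishes at 0 and at infinity
    ([Rintegral_by_parts], [skellam_generator_by_parts]).

    Domination.  For s near t the functions g, g_t, g_tt and g_x at time s are
    all at most K g(x, t/4), because exp(- delta^2 s^2 / (2 x)) absorbs every
    power of 1/x ([ig_derivatives_dominated]).  The majorant is a multiple of
    a probability density, so it is integrable for free.

    Forward equation.  The steps of a Poisson process of order k are at least
    1 almost surely, so each of its masses is a finite sum of Poisson weights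
    and can be differentiated term by term ([poisson_order_kolmogorov]).  The
    Skellam mass q is an infinite series of products of such masses; it is
    never differentiated.  Instead, the integration by parts is done for its
    partial sums, which are bounded by 1 and have uniformly bounded
    derivatives, and both sides converge by dominated convergence.

    Mixture.  The time Y(t) is approximated from above by times on a grid, for
    which conditioning on the time is a countable sum; right-continuity of the
    paths of S carries the formula to the limit ([subordination_pmf]). *)

(** * Dominated convergence and linearity for real-valued integrals *)

Section dominated_convergence_real.
Context {R : realType} {d : measure_display} {T : measurableType d}.
Variables (mu : {measure set T -> \bar R}) (D : set T).

Lemma Rintegral_dominated_cvg (f_ : nat -> T -> R) (f g : T -> R) :
  measurable D -> (forall n, measurable_fun D (f_ n)) ->
  (forall x, D x -> f_ n x @[n --> \oo] --> f x) ->
  mu.-integrable D (EFin \o g) ->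
  (forall n x, D x -> `|f_ n x| <= g x) ->
  mu.-integrable D (EFin \o f) /\
  (\int[mu]_(x in D) f_ n x) @[n --> \oo] --> \int[mu]_(x in D) f x.
Proof.
move=> mD mf_ ff ig fg.
have [] := @dominated_convergence _ _ _ mu D mD (fun n => EFin \o f_ n)
  (EFin \o f) (EFin \o g).
- by move=> n; exact/measurable_EFinP.
- apply/measurable_EFinP; exact: measurable_fun_cvg mf_ ff.
- by apply: aeW => x Dx; apply: cvg_EFin; [exact: nearW|exact: ff].
- exact: ig.
- by apply: aeW => x n Dx /=; rewrite lee_fin; exact: fg.
move=> intf _ H; split => //; apply: fine_cvg.
by rewrite fineK ?integrable_fin_num.
Qed.

End dominated_convergence_real.

Section real_integral_linearity.
Context {R : realType} {d : measure_display} {T : measurableType d}.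
Variables (mu : {measure set T -> \bar R}) (D : set T).
Hypothesis mD : measurable D.

Lemma Rintegral_sum (I : Type) (s : seq I) (f : I -> T -> R) :
  (forall i, mu.-integrable D (EFin \o f i)) ->
  mu.-integrable D (EFin \o (fun x => \sum_(i <- s) f i x)) /\
  \int[mu]_(x in D) (\sum_(i <- s) f i x) = \sum_(i <- s) \int[mu]_(x in D) f i x.
Proof.
move=> intf; elim: s => [|i s [IHi IHs]].
  rewrite big_nil (_ : (fun x => _) = cst 0).
    by split; [exact: integrable0|rewrite /Rintegral integral0].
  by apply/funext => x; rewrite big_nil.
rewrite big_cons (_ : (fun x => _) = f i \+ (fun x => \sum_(j <- s) f j x)); last first.
  by apply/funext => x; rewrite big_cons.
split; last by rewrite RintegralD// IHs.
by have := integrableD mD (intf i) IHi; exact: eq_integrable.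
Qed.

Lemma integrable_scale (r : R) (f : T -> R) : mu.-integrable D (EFin \o f) ->
  mu.-integrable D (EFin \o (fun x => r * f x)).
Proof. by move=> intf; have := integrableZl mD r intf; exact: eq_integrable. Qed.

Lemma integrable_add (f h : T -> R) : mu.-integrable D (EFin \o f) ->
  mu.-integrable D (EFin \o h) -> mu.-integrable D (EFin \o (fun x => f x + h x)).
Proof. by move=> iF iH; have := integrableD mD iF iH; exact: eq_integrable. Qed.

End real_integral_linearity.

(** * Integration over the open half-line *)

Section half_line.
Context {R : realType}.
Local Notation mu := (@lebesgue_measure R).
Local Notation pos := (`]0%R, +oo[%classic : set R).

Lemma posP (x : R) : pos x <-> 0 < x.
Proof. by rewrite /= in_itv/= andbT. Qed.

Lemma measurable_pos : measurable pos.
Proof. exact: measurable_itv. Qed.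

Lemma continuous_pos_measurable (f : R -> R) :
  (forall x : R, 0 < x -> {for x, continuous f}) -> measurable_fun pos f.
Proof.
move=> cf; apply: open_continuous_measurable_fun; first exact: interval_open.
by move=> x; rewrite inE => /posP; exact: cf.
Qed.

Lemma is_derive_continuous (f : R -> R) (x df : R) : is_derive x 1 f df ->
  {for x, continuous f}.
Proof. by case=> ? _; exact/differentiable_continuous/derivable1_diffP. Qed.

Lemma continuous_pos_inv (x : R) : 0 < x -> {for x, continuous (fun y : R => y^-1)}.
Proof. by move=> x0; apply: cvgV; [rewrite gt_eqF|exact: cvg_id]. Qed.

Lemma integrable_dominated (f G : R -> R) (K : R) :
  measurable_fun pos f -> mu.-integrable pos (EFin \o G) ->
  (forall x : R, 0 < x -> `|f x| <= K * G x) -> mu.-integrable pos (EFin \o f).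
Proof.
move=> mf iG fG.
apply: (@le_integrable _ _ _ mu _ measurable_pos _ (fun x => (K%:E * (G x)%:E)%E)).
- exact/measurable_EFinP.
- move=> x /posP x0; rewrite -EFinM lee_fin; apply: le_trans (fG _ x0) _;
    exact: ler_norm.
- by apply: integrableZl => //; exact: measurable_pos.
Qed.

(** The two bounds make h vanish at both ends of the half-line.  By the
    fundamental theorem of calculus the integral of h' over [1/b, b] is
    h(b) - h(1/b), and dominated convergence lets b tend to infinity. *)
Lemma integral_derivative_eq0 (h h' : R -> R) (K : R) :
  (forall x : R, 0 < x -> is_derive x 1 h (h' x)) ->
  (forall x : R, 0 < x -> {for x, continuous h'}) ->
  mu.-integrable `]0, +oo[ (EFin \o h') ->
  (forall x : R, 0 < x -> `|h x| <= K * x /\ `|h x| <= K * x^-1) ->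
  (\int[mu]_(x in `]0, +oo[) h' x = 0)%R.
Proof.
move=> dh ch ih hK.
(* b N >= 2, so that the interval [1/b, b] is not degenerate *)
pose b (N : nat) : R := N.+2%:R; pose I N := `[(b N)^-1, b N]%classic.
have b1 N : 1 < b N by rewrite /b -[1]/(1%:R) ltr_nat.
have b0 N : 0 < b N := lt_trans ltr01 (b1 N).
have ib0 N : 0 < (b N)^-1 by rewrite invr_gt0.
have ibb N : (b N)^-1 < b N by rewrite (lt_trans _ (b1 N))// invf_lt1.
have I0 N (x : R) : I N x -> 0 < x.
  by rewrite /I/= in_itv/= => /andP[+ _]; exact: lt_le_trans.
have FTC N : (\int[mu]_(x in I N) (h' x)%:E = (h (b N) - h (b N)^-1)%:E)%E.
  rewrite (@continuous_FTC2 _ h' h)//.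
  - apply: continuous_in_subspaceT => x /set_mem /I0; exact: ch.
  - have ch1 (x : R) : 0 < x -> {for x, continuous h}.
      by move=> /dh; exact: is_derive_continuous.
    split.
    + move=> x; rewrite in_itv/= => /andP[xb _].
      by have := dh _ (lt_trans (ib0 N) xb); case.
    + by apply: cvg_at_right_filter; exact: ch1.
    + by apply: cvg_at_left_filter; exact: ch1.
  - move=> x; rewrite in_itv/= => /andP[xb _].
    by rewrite derive1E; have := dh _ (lt_trans (ib0 N) xb); case.
have lim0 : (h (b N) - h (b N)^-1) @[N --> \oo] --> 0.
  apply: norm_cvg0.
  apply: (@squeeze_cvgr _ _ _ _ (cst 0) (fun N => 2 * K * harmonic N)).
  - near=> N; rewrite normr_ge0/=.
    have [_ H1] := hK _ (b0 N); have [H2 _] := hK _ (ib0 N).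
    apply: le_trans (ler_normB _ _) _.
    have K0 : 0 <= K.
      by have := le_trans (normr_ge0 _) H1; rewrite pmulr_lge0.
    have : K * (b N)^-1 <= K * harmonic N.
      by rewrite ler_wpM2l// /harmonic /b/= lef_pV2 ?posrE// ler_nat.
    move=> H3; rewrite -[leRHS]mulrA; apply: (le_trans (lerD H1 H2)).
    by rewrite mulr_natl mulr2n lerD.
  - exact: cvg_cst.
  - rewrite -(mulr0 (2 * K)); apply: cvgMr; exact: cvg_harmonic.
have mI N : measurable (I N) by exact: measurable_itv.
have [mh _] := integrableP _ _ _ ih.
have := @dominated_convergence _ _ _ mu `]0, +oo[%classic (measurable_itv _)
  (fun N => (EFin \o h') \_ (I N)) (EFin \o h') (fun x => `|(h' x)%:E|%E).
case.
- move=> N; apply/measurable_restrict => //; first exact: mI.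
  by apply: measurable_funS mh => // x [].
- exact: mh.
- apply: aeW => x x0; apply: cvg_near_cst; near=> N.
  rewrite patchE mem_set// /I/= in_itv/=.
  rewrite /= in_itv/= andbT in x0.
  apply/andP; split.
    rewrite invf_ple ?posrE//; apply: (@le_trans _ _ N%:R);
      last by rewrite /b ler_nat; lia.
    by near: N; exact: nbhs_infty_ger.
  apply: (@le_trans _ _ N%:R); last by rewrite /b ler_nat; lia.
  by near: N; exact: nbhs_infty_ger.
- exact: integrable_abse.
- apply: aeW => x N _ ; rewrite patchE; case: ifP => //=; rewrite normr0 lee_fin//.
move=> _ _ H.
rewrite /Rintegral (_ : (\int[mu]_(x in `]0%R, +oo[) (h' x)%:E)%E = 0%:E)//.
rewrite -[LHS](cvg_lim _ H)//; apply: cvg_lim => //.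
rewrite (_ : [sequence _]_n = EFin \o (fun N => h (b N) - h (b N)^-1)).
  by apply/fine_cvgP; split => //; exact: nearW.
apply/funext => N /=; rewrite -FTC -integral_mkcondr setIidr//.
by move=> x /I0; rewrite /= in_itv/= andbT.
Unshelve. all: end_near. Qed.

End half_line.

(** * Calculus of the inverse Gaussian density *)

(** With a = c / n, 1 + z <= (1 + 1/a) (1 + a z) <= (1 + 1/a) exp(a z), and
    the n-th power of this is the claim.  Used at z = 1/x and at z = x, it
    controls the powers of 1/x and of x that multiply the density. *)
Lemma polynomial_expRN_bounded {R : realType} (n : nat) (c : R) : 0 < c ->
  exists M : R, 0 <= M /\ forall z : R, 0 <= z -> (1 + z) ^+ n * expR (- (c * z)) <= M.
Proof.
move=> c0; case: n => [|n].
  exists 1; split => // z z0; rewrite expr0 mul1r -expR0 ler_expR oppr_le0.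
  by rewrite mulr_ge0// ltW.
pose a := c / n.+1%:R; have a0 : 0 < a by rewrite divr_gt0.
have a0' := ltW a0.
exists ((1 + a^-1) ^+ n.+1); split => [|z z0].
  by rewrite exprn_ge0// addr_ge0// invr_ge0 ltW.
have -> : expR (- (c * z)) = expR (- (a * z)) ^+ n.+1.
  rewrite -expRM_natl; congr expR; rewrite /a; field.
  by rewrite nat1r pnatr_eq0.
rewrite -exprMn lerXn2r ?nnegrE ?mulr_ge0 ?expR_ge0 ?addr_ge0 ?invr_ge0 ?(ltW a0)//.
rewrite expRN ler_pdivrMr ?expR_gt0//.
apply: (@le_trans _ _ ((1 + a^-1) * (1 + a * z))); last first.
  by rewrite ler_wpM2l ?expR_ge1Dx// addr_ge0// invr_ge0 ltW.
have -> : (1 + a^-1) * (1 + a * z) = 1 + z + (a^-1 + a * z).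
  by field; rewrite gt_eqF.
by rewrite lerDl addr_ge0 ?invr_ge0 ?(mulr_ge0 a0').
Qed.

Section ig_density_calculus.
Context {R : realType} (delta gamma : R).
Hypotheses (delta_gt0 : 0 < delta) (gamma_gt0 : 0 < gamma).

Local Notation g := (ig_density delta gamma).

Lemma ig_density_gt0 (x t : R) : 0 < x -> 0 < t -> 0 < g x t.
Proof.
move=> x0 t0; rewrite /ig_density !mulr_gt0 ?powR_gt0 ?expR_gt0//.
by rewrite mulr_gt0 ?pi_gt0.
Qed.

(** The partial derivatives of ln g.  With g factored out, each derivative of
    the density is a rational function times g. *)
Definition ig_dlogt x t : R := t^-1 + delta * gamma - delta ^+ 2 * t * x^-1.

Definition ig_dlogx x t : R :=
  - (3 / 2) * x^-1 + delta ^+ 2 * t ^+ 2 / 2 * x^-1 ^+ 2 - gamma ^+ 2 / 2.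

Definition ig_dt x t : R := ig_dlogt x t * g x t.
Definition ig_dtt x t : R :=
  (ig_dlogt x t ^+ 2 - t^-1 ^+ 2 - delta ^+ 2 * x^-1) * g x t.
Definition ig_dx x t : R := ig_dlogx x t * g x t.

(** After division by g this is an identity between rational functions of x
    and t. *)
Lemma ig_density_pde (x t : R) : 0 < x -> 0 < t ->
  ig_dtt x t - 2 * delta * gamma * ig_dt x t = 2 * delta ^+ 2 * ig_dx x t.
Proof.
move=> x0 t0; rewrite /ig_dtt /ig_dt /ig_dx /ig_dlogt /ig_dlogx; field.
by rewrite !gt_eqF.
Qed.

Lemma is_derive_ig_density_t (x t : R) : 0 < x -> 0 < t ->
  is_derive t 1 (g x) (ig_dt x t).
Proof.
move=> x0 t0; pose C := (2 * pi) `^ (- (1 / 2)) * delta * x `^ (- (3 / 2)).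
pose e (s : R) := delta * gamma * s
     - 1 / 2 * (delta ^+ 2 * s ^+ 2 * x^-1 + gamma ^+ 2 * x).
have -> : g x = (fun s => C * (s * expR (e s))).
  by apply/funext => s; rewrite /ig_density /C /e; ring.
have de : is_derive t 1 e (delta * gamma - delta ^+ 2 * t * x^-1).
  by apply: is_derive_eq; rewrite /GRing.scale/=; field; rewrite gt_eqF.
have dE : is_derive t 1 (expR \o e)
  (expR (e t) * (delta * gamma - delta ^+ 2 * t * x^-1)).
  exact: is_derive1_comp.
have -> : (fun s => C * (s * expR (e s))) = C \*: (id * (expR \o e)) :> (R -> R).
  by apply/funext.
apply: is_derive_eq; rewrite /ig_dt /ig_dlogt /ig_density /GRing.scale/= -/(e t) /C.
by field; rewrite !gt_eqF.
Qed.

Lemma is_derive_ig_dt (x t : R) : 0 < x -> 0 < t ->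
  is_derive t 1 (ig_dt x) (ig_dtt x t).
Proof.
move=> x0 t0.
have dl : is_derive t 1 (ig_dlogt x) (- t^-1 ^+ 2 - delta ^+ 2 * x^-1).
  have dV : is_derive t 1 (fun s : R => s^-1) (- t ^- 2 *: 1).
    by apply: (@is_deriveV R id); rewrite gt_eqF.
  by apply: is_derive_eq; rewrite /GRing.scale/=; field; rewrite !gt_eqF.
have dg := is_derive_ig_density_t x0 t0.
have -> : ig_dt x = ig_dlogt x * g x by apply/funext.
by apply: is_derive_eq; rewrite /GRing.scale/= /ig_dtt /ig_dt; ring.
Qed.

Lemma is_derive_ig_density_x (x t : R) : 0 < x -> 0 < t ->
  is_derive x 1 (g ^~ t) (ig_dx x t).
Proof.
move=> x0 t0; pose C := (2 * pi) `^ (- (1 / 2)) * delta * t.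
pose e (y : R) := delta * gamma * t
     - 1 / 2 * (delta ^+ 2 * t ^+ 2 * y^-1 + gamma ^+ 2 * y).
pose h (y : R) := y `^ (- (3 / 2)).
have -> : g ^~ t = C \*: (h * (expR \o e)) :> (R -> R).
  by apply/funext => y; rewrite /ig_density !fctE /= -/(e y) -/(h y) /C
    /GRing.scale/=; ring.
have dV : is_derive x 1 (fun s : R => s^-1) (- x ^- 2 *: 1).
  by apply: (@is_deriveV R id); rewrite gt_eqF.
have de : is_derive x 1 e (delta ^+ 2 * t ^+ 2 / 2 * x^-1 ^+ 2 - gamma ^+ 2 / 2).
  by apply: is_derive_eq; rewrite /GRing.scale/=; field; rewrite !gt_eqF.
have dE := is_derive1_comp (is_derive_expR (e x)) de.
have dh : is_derive x 1 h (- (3 / 2) * x^-1 * h x).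
  have -> : - (3 / 2) * x^-1 * h x = - (3 / 2) * x `^ (- (3 / 2) - 1) :> R.
    by rewrite powRD ?(gt_eqF x0) ?implybT// powR_inv1 ?ltW// /h; ring.
  exact: is_derive1_powR.
apply: is_derive_eq; rewrite /ig_dx /ig_dlogx /ig_density /GRing.scale/= -/(e x)
  -/(h x) /C.
ring.
Qed.

(** For t > u the quotient g(x, t) / g(x, u/2) contains the factor
    exp(- delta^2 (t^2 - u^2/4) / (2 x)), which absorbs any power of 1/x near
    x = 0.  Comparing with the density at an earlier time makes the bound
    integrable without computing an integral. *)
Lemma ig_density_dominated (u v : R) : 0 < u ->
  exists K : R, 0 <= K /\ forall x t : R, 0 < x -> u < t < v ->
    (1 + x^-1) ^+ 2 * g x t <= K * g x (u / 2).
Proof.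
(* (t^2 - (u/2)^2) / 2 >= 3 u^2 / 8 for t >= u *)
move=> u0; pose c := delta ^+ 2 * (3 / 8) * u ^+ 2.
have c0 : 0 < c by rewrite !mulr_gt0 ?exprn_gt0.
have [M [M0 hM]] := polynomial_expRN_bounded 2 c0.
have [vu|uv] := leP v u.
  exists 0; split => // x t _ /andP[ut tv].
  by move: (lt_trans ut tv); rewrite ltNge vu.
have v0 : 0 < v := lt_trans u0 uv.
have s0 : 0 < u / 2 by rewrite divr_gt0.
exists (v / (u / 2) * expR (delta * gamma * v) * M); split => [|x t x0 /andP[ut tv]].
  by rewrite !mulr_ge0 ?expR_ge0 ?invr_ge0// ltW.
have t0 : 0 < t := lt_trans u0 ut.
have ix0 : 0 <= x^-1 by rewrite invr_ge0 ltW.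
have -> : g x t = t / (u / 2) * expR (delta * gamma * (t - u / 2)) *
    expR (- (1 / 2 * delta ^+ 2 * (t ^+ 2 - (u / 2) ^+ 2) * x^-1)) * g x (u / 2).
  rewrite /ig_density.
  have -> : expR (delta * gamma * t -
        1 / 2 * (delta ^+ 2 * t ^+ 2 * x^-1 + gamma ^+ 2 * x)) =
      expR (delta * gamma * (t - u / 2)) *
      expR (- (1 / 2 * delta ^+ 2 * (t ^+ 2 - (u / 2) ^+ 2) * x^-1)) *
      expR (delta * gamma * (u / 2) -
        1 / 2 * (delta ^+ 2 * (u / 2) ^+ 2 * x^-1 + gamma ^+ 2 * x)).
    by rewrite -!expRD; congr expR; field; rewrite gt_eqF.
  by field; rewrite !gt_eqF.
rewrite mulrA ler_wpM2r ?(ltW (ig_density_gt0 x0 s0))//.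
rewrite mulrCA; apply: ler_pM.
- by rewrite !mulr_ge0 ?expR_ge0 ?invr_ge0// ltW.
- by rewrite mulr_ge0 ?expR_ge0// exprn_ge0// addr_ge0.
- apply: ler_pM; rewrite ?expR_ge0 ?(divr_ge0 (ltW t0) (ltW s0))//.
    by rewrite ler_wpM2r ?invr_ge0 ?(ltW s0) ?(ltW tv).
  rewrite ler_expR ler_wpM2l ?mulr_ge0 ?(ltW delta_gt0) ?(ltW gamma_gt0)//.
  by lra.
- apply: le_trans (hM _ ix0); rewrite ler_wpM2l ?exprn_ge0 ?addr_ge0//.
  rewrite ler_expR lerN2 ler_wpM2r// /c.
  rewrite [leRHS](_ : _ = delta ^+ 2 * (1 / 2 * (t ^+ 2 - (u / 2) ^+ 2))); last by ring.
  rewrite -mulrA ler_wpM2l ?sqr_ge0//.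
  have : u ^+ 2 <= t ^+ 2 by rewrite lerXn2r ?nnegrE ?(ltW u0) ?(ltW t0) ?(ltW ut).
  by lra.
Qed.

(** Each derivative is g times a polynomial of degree at most 2 in 1/x, with
    coefficients that are bounded for t in ]u, v[. *)
Lemma ig_derivatives_dominated (u v : R) : 0 < u ->
  exists K : R, 0 <= K /\ forall x t : R, 0 < x -> u < t < v ->
    [/\ g x t <= K * g x (u / 2), `|ig_dt x t| <= K * g x (u / 2),
        `|ig_dtt x t| <= K * g x (u / 2) & `|ig_dx x t| <= K * g x (u / 2)].
Proof.
move=> u0; have [K [K0 hK]] := ig_density_dominated v u0.
(* L exceeds every coefficient that occurs on ]u, v[ *)
have [L hL] : exists L, L =
  1 + u^-1 + delta * gamma + delta ^+ 2 * v + u^-1 ^+ 2 + delta ^+ 2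
   + 3 / 2 + delta ^+ 2 * v ^+ 2 / 2 + gamma ^+ 2 / 2 by eexists.
have [vu|uv] := leP v u.
  exists 0; split => // x t _ /andP[ut tv].
  by move: (lt_trans ut tv); rewrite ltNge vu.
have v0 : 0 <= v := ltW (lt_trans u0 uv).
have iu0 : 0 <= u^-1 by rewrite invr_ge0 ltW.
have dg0 : 0 <= delta * gamma by rewrite mulr_ge0 ?ltW.
have d20 : 0 <= delta ^+ 2 by rewrite sqr_ge0.
have g20 : 0 <= gamma ^+ 2 by rewrite sqr_ge0.
have iu20 : 0 <= u^-1 ^+ 2 by rewrite sqr_ge0.
have dv0 : 0 <= delta ^+ 2 * v by rewrite mulr_ge0.
have dvv0 : 0 <= delta ^+ 2 * v ^+ 2 by rewrite mulr_ge0// sqr_ge0.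
have L1 : 1 <= L by rewrite hL; lra.
have L0 : 0 <= L by apply: le_trans L1.
have LL : L <= L ^+ 2 *+ 2 by rewrite -mulr_natr -{1}(mulr1 L) -mulrA ler_wpM2l//; lra.
exists (L ^+ 2 *+ 2 * K); split => [|x t x0 /andP[ut tv]].
  by rewrite mulr_ge0// mulrn_wge0// sqr_ge0.
have t0 : 0 < t := lt_trans u0 ut.
have it : t^-1 <= u^-1 by rewrite lef_pV2 ?posrE// ltW.
have it0 : 0 <= t^-1 by rewrite invr_ge0 ltW.
have ix0 : 0 <= x^-1 by rewrite invr_ge0 ltW.
have [y hy] : exists y, x^-1 = y by eexists.
rewrite hy in ix0.
have {}hK := hK _ _ x0 (introT andP (conj ut tv)).
have g0 : 0 <= g x t by rewrite ltW// ig_density_gt0.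
suff H : forall l, `|l : R| <= L ^+ 2 *+ 2 * (1 + y) ^+ 2 ->
    `|l * g x t| <= L ^+ 2 *+ 2 * K * g x (u / 2).
  have dlogt : `|ig_dlogt x t| <= L * (1 + y).
    have E : delta ^+ 2 * t * y <= delta ^+ 2 * v * y.
      by rewrite ler_wpM2r// ler_wpM2l// ltW.
    have E0 : 0 <= delta ^+ 2 * t * y by rewrite !mulr_ge0// ltW.
    have E1 : delta ^+ 2 * v * y <= L * y by rewrite ler_wpM2r// ?hL; lra.
    rewrite /ig_dlogt hy mulrDr mulr1 ler_norml; apply/andP; split.
      have : 0 <= L by []. 
      by lra.
    have : u^-1 + delta * gamma <= L by rewrite hL; lra.
    have : 0 <= L * y by rewrite mulr_ge0.
    by lra.
  split.
  - rewrite -(ger0_norm g0) -[g x t]mul1r; apply: H.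
    rewrite normr1 (le_trans L1)// (le_trans LL)// ler_peMr// ?mulrn_wge0 ?sqr_ge0//.
    by rewrite exprn_ege1// lerDl.
  - apply: H; apply: (le_trans dlogt).
    by rewrite ler_pM ?addr_ge0// expr2 ler_peMr ?addr_ge0 ?lerDl.
  - apply: H; rewrite hy; apply: le_trans (ler_normB _ _) _.
    have E : delta ^+ 2 * y <= L * y by rewrite ler_wpM2r// ?hL; lra.
    have E2 : t^-1 ^+ 2 <= u^-1 ^+ 2 by rewrite lerXn2r ?nnegrE.
    have E3 : `|ig_dlogt x t| ^+ 2 <= L ^+ 2 * (1 + y) ^+ 2.
      by rewrite -exprMn lerXn2r ?nnegrE ?mulr_ge0 ?addr_ge0.
    have E4 : `|t^-1 ^+ 2| + `|delta ^+ 2 * y| <= L ^+ 2 * (1 + y) ^+ 2.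
      rewrite (ger0_norm (sqr_ge0 _)) (ger0_norm (mulr_ge0 d20 ix0)).
      apply: (@le_trans _ _ (L * (1 + y))).
        have : u^-1 ^+ 2 <= L by rewrite hL; lra.
        by lra.
      by rewrite -exprMn expr2 ler_peMr ?mulr_ge0 ?addr_ge0// mulr_ege1// lerDl.
    apply: le_trans (lerD (ler_normB _ _) (lexx _)) _.
    by rewrite normrX mulr2n mulrDl -addrA lerD.
  - apply: H; rewrite /ig_dlogx hy.
    have E1 : delta ^+ 2 * t ^+ 2 / 2 * y ^+ 2 <= L * y ^+ 2.
      rewrite ler_wpM2r ?sqr_ge0//.
      apply: (@le_trans _ _ (delta ^+ 2 * v ^+ 2 / 2)); last by rewrite hL; lra.
      by rewrite ler_wpM2r ?invr_ge0// ler_wpM2l// lerXn2r ?nnegrE ?(ltW t0) ?(ltW tv).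
    have E0 : 0 <= delta ^+ 2 * t ^+ 2 / 2 * y ^+ 2.
      exact: (mulr_ge0 (divr_ge0 (mulr_ge0 d20 (sqr_ge0 t)) (ler0n _ 2)) (sqr_ge0 y)).
    have E2 : 3 / 2 * y <= L * y by rewrite ler_wpM2r// ?hL; lra.
    have E3 : 0 <= gamma ^+ 2 / 2 <= L by rewrite hL; lra.
    have E4 : 0 <= L * y by rewrite mulr_ge0.
    have E5 : 0 <= L * y ^+ 2 by rewrite mulr_ge0 ?sqr_ge0.
    have E6 : 0 <= 3 / 2 * y by rewrite mulr_ge0 ?divr_ge0.
    apply: (@le_trans _ _ (L * (1 + y) ^+ 2)); last first.
      by rewrite ler_wpM2r ?sqr_ge0.
    have -> : L * (1 + y) ^+ 2 = L + 2 * (L * y) + L * y ^+ 2 by ring.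
    rewrite ler_norml.
    by move: E3 => /andP[? ?]; apply/andP; split; lra.
move=> l hl; rewrite normrM (ger0_norm g0).
apply: le_trans (ler_wpM2r g0 hl) _.
rewrite hy in hK; rewrite -[leLHS]mulrA -[leRHS]mulrA ler_wpM2l//.
by rewrite mulrn_wge0// sqr_ge0.
Qed.

(** The bounds on a window around r whose majorant, the density at time r/4,
    depends on r only. *)
Lemma ig_derivatives_dominated_at (r : R) : 0 < r ->
  exists K : R, forall x s : R, 0 < x -> r / 2 < s < r * 2 ->
    [/\ `|g x s| <= K * g x (r / 2 / 2), `|ig_dt x s| <= K * g x (r / 2 / 2),
        `|ig_dtt x s| <= K * g x (r / 2 / 2) & `|ig_dx x s| <= K * g x (r / 2 / 2)].
Proof.
move=> r0; have r20 : 0 < r / 2 by rewrite divr_gt0.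
have [K [K0 hK]] := ig_derivatives_dominated (r * 2) r20.
exists K => x s x0 st; have [] := hK x s x0 st.
have s0 : 0 < s by move: st => /andP[+ _]; exact: lt_trans.
by rewrite (ger0_norm (ltW (ig_density_gt0 x0 s0))).
Qed.

(** From x^(-3/2) <= (1 + 1/x)^2 and x + 1/x <= (1 + x) (1 + 1/x), the product
    g(x, t) (x + 1/x) is at most a constant times
    (1 + 1/x)^3 exp(- a/x) (1 + x) exp(- b x), which is bounded. *)
Lemma ig_density_vanishing (t : R) : 0 < t ->
  exists K : R, forall x : R, 0 < x -> g x t <= K * x /\ g x t <= K * x^-1.
Proof.
move=> t0; pose a := delta ^+ 2 * t ^+ 2 / 2; pose b := gamma ^+ 2 / 2.
have a0 : 0 < a by rewrite !mulr_gt0 ?exprn_gt0.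
have b0 : 0 < b by rewrite !mulr_gt0 ?exprn_gt0.
have [M [M0 hM]] := polynomial_expRN_bounded 3 a0.
have [N [N0 hN]] := polynomial_expRN_bounded 1 b0.
pose C := (2 * pi) `^ (- (1 / 2)) * delta * t * expR (delta * gamma * t) : R.
have C0 : 0 <= C by rewrite /C !mulr_ge0 ?powR_ge0 ?expR_ge0 ?(ltW delta_gt0) ?(ltW t0).
have H (x : R) : 0 < x -> g x t * ((1 + x) * (1 + x^-1)) <= C * M * N.
  move=> x0; have ix0 : 0 < x^-1 by rewrite invr_gt0.
  have -> : g x t = C * (x `^ (- (3 / 2)) * expR (- (a * x^-1)) * expR (- (b * x))).
    rewrite /ig_density.
    have -> : expR (delta * gamma * t -
          1 / 2 * (delta ^+ 2 * t ^+ 2 * x^-1 + gamma ^+ 2 * x)) =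
        expR (delta * gamma * t) * expR (- (a * x^-1)) * expR (- (b * x)).
      by rewrite -!expRD; congr expR; rewrite /a /b; field; rewrite gt_eqF.
    by rewrite /C; ring.
  rewrite -[leRHS]mulrA -[leLHS]mulrA ler_wpM2l//.
  have P : x `^ (- (3 / 2)) <= (1 + x^-1) ^+ 2.
    rewrite powRN -powR_inv1 ?powR_ge0// -powRAC powR_inv1 ?(ltW x0)//.
    rewrite -powR_mulrn ?addr_ge0 ?(ltW ix0)//.
    apply: (@le_trans _ _ ((1 + x^-1) `^ (3 / 2))).
      by rewrite ge0_ler_powR ?nnegrE ?divr_ge0 ?addr_ge0 ?(ltW ix0) ?lerDr.
    rewrite ler_powR ?lerDl ?(ltW ix0)//; lra.
  apply: (@le_trans _ _ ((1 + x^-1) ^+ 3 * expR (- (a * x^-1)) * ((1 + x) ^+ 1 *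
    expR (- (b * x))))).
    rewrite [leLHS](_ : _ = x `^ (- (3 / 2)) *
      (expR (- (a * x^-1)) * expR (- (b * x)) * ((1 + x) * (1 + x^-1)))); last by ring.
    rewrite [leRHS](_ : _ = (1 + x^-1) ^+ 2 *
      (expR (- (a * x^-1)) * expR (- (b * x)) * ((1 + x) * (1 + x^-1)))); last by ring.
    by rewrite ler_wpM2r// !mulr_ge0 ?expR_ge0 ?addr_ge0 ?(ltW x0) ?(ltW ix0).
  by apply: ler_pM; rewrite ?hM ?hN ?(ltW x0) ?(ltW ix0)// mulr_ge0 ?expR_ge0
    ?exprn_ge0 ?addr_ge0 ?(ltW x0) ?(ltW ix0).
exists (C * M * N) => x x0; have {}H := H _ x0.
have ix0 : 0 < x^-1 by rewrite invr_gt0.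
have g0 := ltW (ig_density_gt0 x0 t0).
have E : (1 + x) * (1 + x^-1) = 2 + x + x^-1 by field; rewrite gt_eqF.
rewrite E in H; split.
  rewrite -ler_pdivrMr//; apply: le_trans H; rewrite ler_wpM2l//; lra.
rewrite -ler_pdivrMr// invrK; apply: le_trans H; rewrite ler_wpM2l//; lra.
Qed.
End ig_density_calculus.

(** * Integrals against the inverse Gaussian density *)

Section ig_integrals.
Context {R : realType} (delta gamma : R).
Hypotheses (delta_gt0 : 0 < delta) (gamma_gt0 : 0 < gamma).
Local Notation mu := (@lebesgue_measure R).
Local Notation pos := (`]0%R, +oo[%classic : set R).
Local Notation g := (ig_density delta gamma).
Local Notation g_t := (ig_dt delta gamma).
Local Notation g_tt := (ig_dtt delta gamma).
Local Notation g_x := (ig_dx delta gamma).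
Hypothesis ig_integrable : forall t : R, 0 < t -> mu.-integrable pos (EFin \o g^~ t).

Lemma continuous_ig_density (x t : R) : 0 < x -> 0 < t -> {for x, continuous (g^~ t)}.
Proof. by move=> x0 t0; apply: is_derive_continuous
  (is_derive_ig_density_x _ _ x0 t0). Qed.

Lemma continuous_ig_dt (x t : R) : 0 < x -> 0 < t -> {for x, continuous (g_t^~ t)}.
Proof.
move=> x0 t0; have ci := continuous_pos_inv x0.
apply: continuousM; last exact: continuous_ig_density.
by apply: continuousB; [exact: cst_continuous|apply: continuousM => //;
  exact: cst_continuous].
Qed.

Lemma continuous_ig_dtt (x t : R) : 0 < x -> 0 < t -> {for x, continuous (g_tt^~ t)}.
Proof.
move=> x0 t0; have ci := continuous_pos_inv x0.
apply: continuousM; last exact: continuous_ig_density.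
apply: continuousB; last by apply: continuousM => //; exact: cst_continuous.
apply: continuousB; last exact: cst_continuous.
have cl : {for x, continuous (ig_dlogt delta gamma ^~ t)}.
  by apply: continuousB; [exact: cst_continuous|apply: continuousM => //;
    exact: cst_continuous].
exact: (continuousM cl cl).
Qed.

Lemma continuous_ig_dx (x t : R) : 0 < x -> 0 < t -> {for x, continuous (g_x^~ t)}.
Proof.
move=> x0 t0; have ci := continuous_pos_inv x0.
apply: continuousM; last exact: continuous_ig_density.
apply: continuousB; last exact: cst_continuous.
apply: continuousD; apply: continuousM; try exact: cst_continuous; first exact: ci.
exact: (continuousM ci ci).
Qed.

(** There is no boundary term: u is bounded and g vanishes at both ends. *)
Lemma Rintegral_by_parts (u u' : R -> R) (C t : R) : 0 < t ->
  (forall x : R, 0 < x -> is_derive x 1 u (u' x)) ->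
  (forall x : R, 0 < x -> {for x, continuous u'}) ->
  (forall x : R, 0 < x -> `|u x| <= 1) -> (forall x : R, 0 < x -> `|u' x| <= C) ->
  \int[mu]_(x in pos) (u x * g_x x t) = - \int[mu]_(x in pos) (u' x * g x t).
Proof.
move=> t0 du cu' u1 u'C.
have [K hK] := ig_derivatives_dominated_at delta_gt0 gamma_gt0 t0.
have tt : t / 2 < t < t * 2 by lra.
have {}hK (x : R) x0 := hK x t x0 tt.
have t40 : 0 < t / 2 / 2 by rewrite !divr_gt0.
have cu (x : R) : 0 < x -> {for x, continuous u} by move=> /du;
  exact: is_derive_continuous.
have i1 : mu.-integrable pos (EFin \o (fun x => u x * g_x x t)).
  apply: (integrable_dominated (K := K) _ (ig_integrable t40)).
    apply: continuous_pos_measurable => x x0; apply: continuousM; first exact: cu.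
    exact: continuous_ig_dx.
  move=> x x0; have [_ _ _ H] := hK x x0; rewrite normrM; apply: le_trans _ H.
  by rewrite ler_piMl// u1.
have i2 : mu.-integrable pos (EFin \o (fun x => u' x * g x t)).
  apply: (integrable_dominated (K := C) _ (ig_integrable t0)).
    apply: continuous_pos_measurable => x x0; apply: continuousM; first exact: cu'.
    exact: continuous_ig_density.
  move=> x x0; have g0 := ltW (ig_density_gt0 gamma delta_gt0 x0 t0).
  by rewrite normrM (ger0_norm g0) ler_wpM2r// u'C.
have [L hL] := ig_density_vanishing delta_gt0 gamma_gt0 t0.
apply/eqP; rewrite -subr_eq0 opprK -RintegralD//.
apply/eqP; apply: (integral_derivative_eq0 (h := fun x => u x * g x t) (K := L)).
- move=> x x0; have := du x x0; have := is_derive_ig_density_x delta gamma x0 t0.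
  move=> dg dux; rewrite -[fun x => u x * _]/(u * g^~ t).
  by apply: is_derive_eq; rewrite /GRing.scale/= [g x t * _]mulrC.
- move=> x x0; apply: continuousD; apply: continuousM.
  + exact: cu.
  + exact: continuous_ig_dx.
  + exact: cu'.
  + exact: continuous_ig_density.
- have := @integrableD _ _ _ mu pos (measurable_itv _) _ _ i1 i2.
  exact: eq_integrable.
- move=> x x0; have [H1 H2] := hL x x0.
  have g0 := ltW (ig_density_gt0 gamma delta_gt0 x0 t0).
  by split; [apply: le_trans _ H1|apply: le_trans _ H2];
    rewrite normrM (ger0_norm g0) ler_piMl// u1.
Qed.

Section weighted_integrals.
Variables (q : R -> R).
Hypothesis mq : measurable_fun pos q.
Hypothesis q1 : forall x : R, 0 < x -> `|q x| <= 1.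

Lemma ig_weighted_integrable (f : R -> R) (K s : R) : 0 < s ->
  (forall x : R, 0 < x -> {for x, continuous f}) ->
  (forall x : R, 0 < x -> `|f x| <= K * g x s) ->
  mu.-integrable pos (EFin \o (fun x => q x * f x)).
Proof.
move=> s0 cf fK; apply: (integrable_dominated (K := K) _ (ig_integrable s0)).
  by apply: measurable_funM => //; exact: continuous_pos_measurable.
move=> x x0; rewrite normrM; apply: le_trans (fK _ x0).
by rewrite ler_piMl// q1.
Qed.

(** Differentiation under the integral sign, on the window ]t/2, 2t[ where a
    multiple of the density at time t/4 dominates. *)
Lemma is_derive_weighted_integral (f f' : R -> R -> R) (t : R) : 0 < t ->
  (forall x s : R, 0 < x -> 0 < s -> is_derive s 1 (f x) (f' x s)) ->
  (forall s : R, 0 < s -> mu.-integrable pos (EFin \o (fun x => q x * f x s))) ->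
  (exists K : R, forall x s : R, 0 < x -> t / 2 < s < t * 2 ->
    `|f' x s| <= K * g x (t / 2 / 2)) ->
  is_derive t 1 (fun s => \int[mu]_(x in pos) (q x * f x s))
    (\int[mu]_(x in pos) (q x * f' x t)).
Proof.
move=> t0 df intf [K hK].
pose F (s x : R) := q x * f x s.
have s_gt0 (s : R) : `]t / 2, t * 2[%classic s -> 0 < s.
  by rewrite /= in_itv/= => /andP[ts _]; apply: lt_trans ts; rewrite divr_gt0.
have It : `]t / 2, t * 2[%classic t by rewrite /= in_itv/=; lra.
have dF (s x : R) : 0 < s -> 0 < x -> is_derive s 1 (F ^~ x) (q x * f' x s).
  by move=> s0 x0; have := df x s x0 s0 => dfx; apply: is_derive_eq.
have t40 : 0 < t / 2 / 2 by rewrite !divr_gt0.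
pose G x := `|K| * `|g x (t / 2 / 2)|.
have iF (s : R) : `]t / 2, t * 2[%classic s -> mu.-integrable pos (EFin \o F s).
  by move=> /s_gt0; exact: intf.
have derF (s x : R) : `]t / 2, t * 2[%classic s -> pos x -> derivable (F ^~ x) s 1.
  by move=> /s_gt0 s0 /posP x0; have [] := dF _ _ s0 x0.
have dFE (s x : R) : 0 < s -> 0 < x -> partial1of2 F s x = q x * f' x s.
  by move=> s0 x0; rewrite partial1of2E; have [] := dF _ _ s0 x0.
have G0 y : 0 <= G y by rewrite mulr_ge0.
have iG : mu.-integrable pos (EFin \o G).
  have := @integrableZl _ _ _ mu pos (measurable_itv _) `|K| _ (integrable_abse
    (ig_integrable t40)).
  by apply: eq_integrable.
have Gub (s x : R) : `]t / 2, t * 2[%classic s -> pos x -> `|partial1of2 F s x| <= G x.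
  move=> Is /posP x0; rewrite dFE ?(s_gt0 _ Is)// normrM.
  apply: (@le_trans _ _ `|f' x s|); first by rewrite ler_piMl// q1.
  have := hK x s x0; rewrite /= in_itv/= in Is => /(_ Is) /le_trans; apply.
  by rewrite /G -normrM ler_norm.
have E : \int[mu]_(x in pos) (q x * f' x t) = \int[mu]_(x in pos) partial1of2 F t x.
  by apply: eq_Rintegral => x /set_mem /posP x0; rewrite dFE.
rewrite E; apply: DeriveDef.
  exact: (@derivable_under_integral R _ _ mu F pos
    (measurable_itv _) t _ _ It iF derF G G0 iG Gub).
rewrite -derive1E.
exact: (@differentiation_under_integral R _ _ mu F pos
  (measurable_itv _) t _ _ It iF derF G G0 iG Gub).
Qed.

Lemma ig_weighted_derivatives_integrable (t : R) : 0 < t ->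
  [/\ mu.-integrable pos (EFin \o (fun x => q x * g x t)),
      mu.-integrable pos (EFin \o (fun x => q x * g_t x t)),
      mu.-integrable pos (EFin \o (fun x => q x * g_tt x t)) &
      mu.-integrable pos (EFin \o (fun x => q x * g_x x t))].
Proof.
move=> t0; have [K hK] := ig_derivatives_dominated_at delta_gt0 gamma_gt0 t0.
have tt : t / 2 < t < t * 2 by lra.
have t40 : 0 < t / 2 / 2 by rewrite !divr_gt0.
by split; apply: (ig_weighted_integrable (K := K) t40) => x x0;
  have [b bt btt bx] := hK x t x0 tt => //;
  [exact: continuous_ig_density|exact: continuous_ig_dt|exact: continuous_ig_dtt|
   exact: continuous_ig_dx].
Qed.

Lemma ig_weighted_derivatives (t : R) : 0 < t ->
  is_derive t 1 (fun s => \int[mu]_(x in pos) (q x * g x s))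
    (\int[mu]_(x in pos) (q x * g_t x t)) /\
  is_derive t 1 (fun s => \int[mu]_(x in pos) (q x * g_t x s))
    (\int[mu]_(x in pos) (q x * g_tt x t)).
Proof.
move=> t0; have [K hK] := ig_derivatives_dominated_at delta_gt0 gamma_gt0 t0.
split; apply: is_derive_weighted_integral => //.
- by move=> x s x0 s0; exact: is_derive_ig_density_t.
- by move=> s /ig_weighted_derivatives_integrable[].
- by exists K => x s x0 st; have [] := hK x s x0 st.
- by move=> x s x0 s0; exact: is_derive_ig_dt.
- by move=> s /ig_weighted_derivatives_integrable[].
- by exists K => x s x0 st; have [] := hK x s x0 st.
Qed.

Lemma ig_weighted_pde (t : R) : 0 < t ->
  \int[mu]_(x in pos) (q x * g_tt x t) - 2 * delta * gamma *
    \int[mu]_(x in pos) (q x * g_t x t) =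
  2 * delta ^+ 2 * \int[mu]_(x in pos) (q x * g_x x t).
Proof.
move=> t0; have [_ i1 i2 i3] := ig_weighted_derivatives_integrable t0.
rewrite -!RintegralZl//; [|exact: measurable_itv..].
rewrite -RintegralB//; last first.
  by have := @integrableZl _ _ _ mu pos (measurable_itv _) (2 * delta *
    gamma) _ i1; exact: eq_integrable.
apply: eq_Rintegral => x /set_mem /posP x0.
by rewrite [in RHS]mulrCA -ig_density_pde//; ring.
Qed.

End weighted_integrals.
End ig_integrals.

(** * Total probability and sums of independent steps *)

Lemma sum_ord_widen0 {R : realType} (F : nat -> R) (n N : nat) : (n <= N)%N ->
  (forall i, (n <= i)%N -> F i = 0) -> \sum_(i < N) F i = \sum_(i < n) F i.
Proof.
move=> nN F0; rewrite -!(big_mkord xpredT F)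
  (@big_cat_nat _ _ _ n 0%N N)//= -[RHS]addr0.
by congr (_ + _); rewrite big_nat big1// => i /andP[ni _]; exact: F0.
Qed.

Section total_probability.
Context {d : measure_display} {T : measurableType d} {R : realType}.
Variable P : probability T R.

Lemma probability_EFin (A : set T) : measurable A -> P A = (fine (P A))%:E.
Proof. by move=> mA; rewrite fineK// fin_num_measure. Qed.

Lemma fine_probability_le1 (A : set T) : measurable A -> fine (P A) <= 1.
Proof. by move=> mA; rewrite -lee_fin -probability_EFin// probability_le1. Qed.

Lemma measurable_discrete_preimage (f : T -> nat) (A : set nat) :
  measurable_fun setT f -> measurable (f @^-1` A).
Proof. by move=> mf; rewrite -[_ @^-1` _]setTI; exact: mf. Qed.

Lemma total_probability_cvg (f : T -> nat) (A : set T) :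
  measurable_fun setT f -> measurable A ->
  (\sum_(i < M) fine (P (A `&` f @^-1` [set (i : nat)]))) @[M --> \oo] --> fine (P A).
Proof.
move=> mf mA; pose F i := A `&` f @^-1` [set i].
have mF i : measurable (F i).
  by apply: measurableI => //; exact: measurable_discrete_preimage.
have UF : \bigcup_i F i = A.
  by apply/seteqP; split => [x [i _ []]|x Ax]//; exists (f x).
have tF : trivIset setT F.
  by apply/trivIsetP => i j _ _ /eqP ij; apply/seteqP; split => // x [[_ fi] [_ fj]];
    apply: ij; rewrite -fi -fj.
have /fine_cvg : (\sum_(i < M) P (F i))%E @[M --> \oo] --> (fine (P A))%:E.
  rewrite -probability_EFin// -UF.
  have := @measure_semi_sigma_additive _ _ _ P F mF tF.
  rewrite UF => /(_ mA).
  by under eq_fun do rewrite big_mkord.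
apply: cvg_trans; apply: near_eq_cvg; apply: nearW => M /=.
by rewrite -sum_fine// => i _; exact: fin_num_measure.
Qed.

Lemma total_probability_finite (f : T -> nat) (A : set T) (N : nat) :
  measurable_fun setT f -> measurable A ->
  (forall i, (N <= i)%N -> fine (P (A `&` f @^-1` [set i])) = 0) ->
  fine (P A) = \sum_(i < N) fine (P (A `&` f @^-1` [set (i : nat)])).
Proof.
move=> mf mA H; have H1 := total_probability_cvg mf mA.
rewrite -[LHS](cvg_lim _ H1)//; apply: lim_near_cst => //; near=> M.
have NM : (N <= M)%N by near: M; exact: nbhs_infty_ge.
exact: (sum_ord_widen0 (F := fun i => fine (P (A `&` f @^-1` [set i])))).
Unshelve. all: end_near. Qed.

End total_probability.

Section partial_sums.
Context {d : measure_display} {T : measurableType d} {R : realType}.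
Variable P : probability T R.
Variable X : nat -> T -> nat.
Hypothesis mX : forall i, measurable_fun setT (X i).
Hypothesis iX : mutually_independent P X.

Let S (j : nat) (w : T) : nat := (\sum_(i < j) X i w)%N.
Let cyl (J : {fset nat}) (A : nat -> set nat) : set T :=
  \bigcap_(i in [set` J]) (X i @^-1` A i).

Lemma measurable_partial_sum (j : nat) : measurable_fun setT (S j).
Proof.
elim: j => [|j IH].
  by rewrite (_ : S 0 = cst 0%N)//; apply/funext => w; rewrite /S big_ord0.
rewrite (_ : S j.+1 = fun w => (S j w + X j w)%N); first exact: measurable_fun_addn.
by apply/funext => w; rewrite /S big_ord_recr.
Qed.

(** The independence of the counting process and of the steps is a property of
    generated sigma-algebras, so the events of interest must be placed there:
    each step is measurable for the sigma-algebra that the steps generate, and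
    therefore so are their sums. *)
Lemma partial_sum_generated (j m : nat) :
  generated_sigma_algebra setT X [set w | S j w = m].
Proof.
rewrite /generated_sigma_algebra; set G := (X in <<s X>>).
have mXG i : @measurable_fun _ _ (g_sigma_algebraType G) nat setT (X i).
  move=> _ A _; rewrite setTI; apply: sub_sigma_algebra.
  by exists i => //; exists A => //; rewrite setTI.
have mS : @measurable_fun _ _ (g_sigma_algebraType G) nat setT (S j).
  elim: j => [|j IH].
    by rewrite (_ : S 0 = cst 0%N)//; apply/funext => w; rewrite /S big_ord0.
  rewrite (_ : S j.+1 = fun w => (S j w + X j w)%N); first exact: measurable_fun_addn.
  by apply/funext => w; rewrite /S big_ord_recr.
by have := mS measurableT [set m] I; rewrite setTI.
Qed.

Lemma measurable_cyl J A : measurable (cyl J A).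
Proof.
apply: fin_bigcap_measurable => // i _; exact: measurable_discrete_preimage.
Qed.

Let indep_at (j : nat) := forall m (J : {fset nat}) (A : nat -> set nat),
  (forall i, i \in J -> (j <= i)%N) ->
  fine (P ([set w | S j w = m] `&` cyl J A)) =
  fine (P [set w | S j w = m]) * \prod_(i <- J) fine (P (X i @^-1` A i)).

(** Splitting the event according to the value of the step j replaces J by
    j |` J, a family that still lies beyond the indices of the shorter sum. *)
Let step (j : nat) : indep_at j -> forall m (J : {fset nat}) (A : nat -> set nat),
  (forall i, i \in J -> (j < i)%N) ->
  fine (P ([set w | S j.+1 w = m] `&` cyl J A)) =
  (\sum_(l < m.+1) fine (P [set w | S j w =
    (m - l)%N]) * fine (P (X j @^-1` [set (l : nat)]))) *
  \prod_(i <- J) fine (P (X i @^-1` A i)).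
Proof.
move=> IH m J A hJ.
have SE w : S j.+1 w = (S j w + X j w)%N by rewrite /S big_ord_recr.
have jJ : j \notin J by apply/negP => /hJ; rewrite ltnn.
rewrite (@total_probability_finite _ _ _ P (X j) _ m.+1)//; first last.
- move=> i mi; rewrite (_ : _ `&` _ = set0) ?measure0//.
  by apply/seteqP; split => // w [[/= + _] Xi]; rewrite SE Xi; lia.
- apply: measurableI; last exact: measurable_cyl.
  exact: (measurable_discrete_preimage [set m] (measurable_partial_sum j.+1)).
rewrite mulr_suml; apply: eq_bigr => -[l /= lm] _.
pose A' i := if i == j then [set l] else A i.
have -> : [set w | S j.+1 w = m] `&` cyl J A `&` X j @^-1` [set l] =
    [set w | S j w = (m - l)%N] `&` cyl (j |` J)%fset A'.
  apply/seteqP; split => w /=.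
    move=> [[+ cw] Xl]; rewrite SE Xl => Sm; split; first lia.
    move=> i /=; rewrite in_fset1U /A'; case: eqVneq => [-> _|_ /= iJ]; first exact: Xl.
    exact: cw.
  move=> [Sm cw]; have Xl : X j w = l.
    by have := cw j; rewrite /= in_fset1U eqxx /A' eqxx; apply.
  split=> //; split; first by rewrite SE Sm Xl; lia.
  move=> i /= iJ; have := cw i; rewrite /= in_fset1U iJ orbT /A' => /(_ isT).
  by case: eqVneq iJ jJ => // -> ->.
rewrite IH; last by move=> i; rewrite in_fset1U => /predU1P[->//|/hJ/ltnW].
rewrite big_fsetU1//= /A' eqxx mulrA; congr (_ * _).
rewrite !big_seq; apply: eq_bigr => i iJ; case: eqVneq iJ jJ => // -> ij.
by rewrite ij.
Qed.

(** Mutual independence speaks of single steps only.  The induction on the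
    length of the sum needs the whole family J of later steps, because the
    last summand is moved into J. *)
Lemma partial_sum_independent (j m : nat) (J : {fset nat}) (A : nat -> set nat) :
  (forall i, i \in J -> (j <= i)%N) ->
  fine (P ([set w | S j w = m] `&` cyl J A)) =
  fine (P [set w | S j w = m]) * \prod_(i <- J) fine (P (X i @^-1` A i)).
Proof.
elim: j m J A => [|j IH] m J A hJ.
  have [->|m0] := eqVneq m 0%N.
    rewrite (_ : [set w | S 0 w = 0%N] = setT); last first.
      by apply/seteqP; split => w // _; rewrite /= /S big_ord0.
    rewrite setTI probability_setT/= mul1r /cyl iX//.
    rewrite (eq_bigr (fun i => (fine (P (X i @^-1` A i)))%:E)); last first.
      by move=> i _; rewrite -probability_EFin//; exact: measurable_discrete_preimage.
    by rewrite prodEFin.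
  rewrite (_ : [set w | S 0 w = m] = set0); last first.
    by apply/seteqP; split => w //; rewrite /= /S big_ord0 => /esym/eqP;
      rewrite (negbTE m0).
  by rewrite set0I measure0/= mul0r.
rewrite step//; congr (_ * _).
have := @step j IH m fset0 A; rewrite big_seq_fset0 mulr1 => <- //.
by rewrite /cyl set_fset0 bigcap_set0 setIT.
Qed.

Lemma partial_sum_convolution (j m : nat) :
  fine (P [set w | S j.+1 w = m]) =
  \sum_(l < m.+1) fine (P [set w | S j w =
    (m - l)%N]) * fine (P (X j @^-1` [set (l : nat)])).
Proof.
have := @step j (@partial_sum_independent j) m fset0 (fun=> setT).
rewrite big_seq_fset0 mulr1 => <- //.
by rewrite /cyl set_fset0 bigcap_set0 setIT.
Qed.

End partial_sums.

(** * The Poisson process of order k *)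

Lemma is_derive_poisson_term {R : realType} (c x : R) (j : nat) :
  is_derive x 1 (fun y => (c * y) ^+ j * j`!%:R^-1 * expR (- (c * y)))
    (c * ((if j is i.+1 then (c * x) ^+ i * i`!%:R^-1 * expR (- (c * x)) else 0)
          - (c * x) ^+ j * j`!%:R^-1 * expR (- (c * x)))).
Proof.
pose l (y : R) := c * y.
have dl : is_derive x 1 l c by apply: is_derive_eq; rewrite /GRing.scale/= mulr1.
pose m (y : R) := - (c * y).
have dm : is_derive x 1 m (- c) by apply: is_derive_eq; rewrite /GRing.scale/=; ring.
have dE := is_derive1_comp (is_derive_expR (m x)) dm.
have -> : (fun y => (c * y) ^+ j * j`!%:R^-1 * expR (- (c * y))) =
    j`!%:R^-1 \*: (l ^+ j * (expR \o m)) :> (R -> R).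
  by apply/funext => y; rewrite !fctE /= /GRing.scale/= -/(l y) -/(m y); ring.
apply: is_derive_eq; rewrite /GRing.scale/= -/(l x) -/(m x).
rewrite exprfctE; case: j => [|j] /=; first by rewrite !expr0 !mul0r fact0 invr1; ring.
rewrite factS natrM exprS.
field.
by rewrite nat1r !pnatr_eq0 -!lt0n fact_gt0.
Qed.

Section compound_poisson.
Context {d : measure_display} {T : measurableType d} {R : realType}.
Variable P : probability T R.

(** Indexed by integers although the variable takes natural values: shifts by
    a jump then need no side condition, the mass being 0 at negative places. *)
Definition pmf_at (f : T -> nat) (z : int) : R := fine (P [set w | (f w)%:Z = z]).

Lemma pmf_at_nat (f : T -> nat) (m : nat) : pmf_at f m%:Z = fine (P [set w | f w = m]).
Proof.
rewrite /pmf_at (_ : [set w | (f w)%:Z = m%:Z] = [set w | f w = m])//.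
by apply/seteqP; split => w /= => [[]|->].
Qed.

Lemma pmf_at_neg (f : T -> nat) (z : int) : z < 0 -> pmf_at f z = 0.
Proof.
move=> z0; rewrite /pmf_at (_ : [set w | _] = set0) ?measure0//.
by apply/seteqP; split => w //= fz; move: z0; rewrite -fz.
Qed.

Lemma pmf_at_ge0 (f : T -> nat) (z : int) : 0 <= pmf_at f z.
Proof. by rewrite fine_ge0. Qed.

Section uniform_steps.
Variables (k : nat) (X : nat -> T -> nat).
Hypothesis k_gt0 : (1 <= k)%N.
Hypothesis mX : forall i, measurable_fun setT (X i).
Hypothesis uX : forall i j, (1 <= j <= k)%N -> P (X i @^-1` [set j]) = (k%:R^-1)%:E.
Hypothesis iX : mutually_independent P X.

Let S (j : nat) (w : T) : nat := (\sum_(i < j) X i w)%N.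

(** The k prescribed masses add up to 1, so nothing is left for the values
    outside 1, ..., k. *)
Lemma uniform_step_pmf (i l : nat) :
  fine (P (X i @^-1` [set l])) = if (1 <= l <= k)%N then k%:R^-1 else 0.
Proof.
case: ifPn => [lk|lk]; first by rewrite uX.
pose A := X i @^-1` [set l | (1 <= l <= k)%N].
have mA : measurable A by exact: measurable_discrete_preimage.
have PA : fine (P A) = 1.
  rewrite (@total_probability_finite _ _ _ P (X i) A k.+1)//; last first.
    move=> j kj; rewrite (_ : _ `&` _ = set0) ?measure0//.
    by apply/seteqP; split => // w []; rewrite /A /= => + jE; rewrite jE; lia.
  rewrite big_ord_recl [X in X + _](_ : _ = 0) ?add0r; last first.
    rewrite (_ : _ `&` _ = set0) ?measure0//.
    by apply/seteqP; split => // w []; rewrite /A /= => + jE; rewrite jE.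
  rewrite (eq_bigr (fun=> k%:R^-1)).
    by rewrite sumr_const card_ord -[_ *+ _]mulr_natr mulVf// pnatr_eq0 -lt0n.
  move=> j _; rewrite (_ : _ `&` _ = X i @^-1` [set j.+1]).
    by rewrite uX//= ltn_ord.
  apply/seteqP; split => w; first by case.
  by move=> /= Xj; split => //=; rewrite /A/= Xj ltn_ord.
apply/eqP; rewrite eq_le fine_ge0// andbT.
have : fine (P (X i @^-1` [set l])) <= fine (P (~` A)).
  rewrite fine_le ?fin_num_measure//; [|exact: measurableC|apply: le_measure].
  - exact: measurable_discrete_preimage.
  - by rewrite inE; exact: measurable_discrete_preimage.
  - by rewrite inE; exact: measurableC.
  - by move=> w /= Xl; rewrite /A/= Xl; exact/negP.
by rewrite probability_setC// (probability_EFin P mA) PA subee.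
Qed.

Lemma uniform_sum_recurrence (j : nat) (z : int) :
  pmf_at (S j.+1) z = k%:R^-1 * \sum_(1 <= l < k.+1) pmf_at (S j) (z - l%:Z).
Proof.
case: z => [m|m]; last first.
  rewrite pmf_at_neg// big1 ?mulr0// => l _; rewrite pmf_at_neg//; lia.
rewrite -[Posz m]/(m%:Z) pmf_at_nat (partial_sum_convolution mX iX).
pose F l := pmf_at (S j) (m%:Z - l%:Z) * fine (P (X j @^-1` [set l])).
transitivity (\sum_(l < m.+1) F l).
  apply: eq_bigr => -[l /= lm] _; rewrite /F -pmf_at_nat; congr (pmf_at _ _ * _).
  lia.
rewrite -(@sum_ord_widen0 R F m.+1 (m + k).+1); first last.
- by move=> l ml; rewrite /F pmf_at_neg ?mul0r//; lia.
- lia.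
rewrite (@sum_ord_widen0 R F k.+1); first last.
- by move=> l kl; rewrite /F uniform_step_pmf ifF ?mulr0//; lia.
- lia.
rewrite -(big_mkord xpredT F) big_nat_recl// {1}/F uniform_step_pmf/= mulr0 add0r.
rewrite big_add1/= mulr_sumr !big_nat; apply: eq_bigr => l lk.
by rewrite /F uniform_step_pmf ifT; [rewrite mulrC|lia].
Qed.

(** Almost surely every step is at least 1.  This is what makes the mass
    function of the compound sum a finite sum of Poisson weights. *)
Lemma uniform_sum_small (j : nat) (z : int) : z < j%:Z -> pmf_at (S j) z = 0.
Proof.
elim: j z => [|j IH] z zj; first exact: pmf_at_neg.
rewrite uniform_sum_recurrence big_nat big1 ?mulr0// => l lk.
apply: IH; lia.
Qed.

End uniform_steps.

Section poisson_order.
Variables (k : nat) (lambda : R) (Nk : R -> T -> nat).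
Hypotheses (k_gt0 : (1 <= k)%N) (lambda_gt0 : 0 < lambda).
Hypothesis hNk : poisson_process_order P k lambda Nk.

Lemma poisson_order_measurable (x : R) : 0 <= x -> measurable_fun setT (Nk x).
Proof.
move=> x0; have [N [X [hN [mX _] _ _ NkE]]] := hNk.
move=> _ A _; rewrite setTI.
pose S (j : nat) (w : T) : nat := (\sum_(i < j) X i w)%N.
rewrite (_ : _ @^-1` _ = \bigcup_j (N x @^-1` [set j] `&` S j @^-1` A)).
  apply: bigcupT_measurable => j; apply: measurableI.
    exact: measurable_discrete_preimage (poisson_process_measurable hN x0).
  exact: measurable_discrete_preimage (measurable_partial_sum mX j).
apply/seteqP; split => w /=; first by rewrite NkE// => AS; exists (N x w).
by move=> [j _ [/= NE AS]]; rewrite NkE// NE.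
Qed.

Lemma poisson_order_right_continuous (x : R) w : 0 <= x ->
  \forall s \near x^'+, Nk s w = Nk x w.
Proof.
move=> x0; have [N [X [hN _ _ _ NkE]]] := hNk.
have Ncst : \forall s \near x^'+, N s w = N x w.
  have : N s w @[s --> x^'+] --> N x w := poisson_process_right_continuous hN x0.
  by move/discrete_cvg.
near=> s; rewrite !NkE//; last by apply: ltW; apply: le_lt_trans x0 _; near: s;
  exact: nbhs_right_gt.
by rewrite (near Ncst s).
Unshelve. all: end_near. Qed.

(** The mass at z is the finite sum over j <= z of the Poisson weight w_j
    times the mass at z of a sum of j steps.  The weights satisfy
    w_j' = c (w_(j-1) - w_j) with c = k lambda; shifting the index j turns
    w_(j-1) into one more step, and a step is uniform on 1, ..., k. *)
Lemma poisson_order_kolmogorov (z : int) (x : R) : 0 < x ->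
  is_derive x 1 (fun y => pmf_at (Nk y) z)
    (lambda * (\sum_(1 <= l < k.+1) pmf_at (Nk x) (z - l%:Z)) - k%:R * lambda *
      pmf_at (Nk x) z).
Proof.
have [N [X [hN [mX uX] iX iNX NkE]]] := hNk.
pose S (j : nat) (w : T) : nat := (\sum_(i < j) X i w)%N.
pose c := k%:R * lambda.
have c0 : 0 < c by rewrite mulr_gt0// ltr0n.
pose W (j : nat) (y : R) : R := (c * y) ^+ j * j`!%:R^-1 * expR (- (c * y)).
have law (y : R) (u : int) (M : nat) : 0 < y -> u < M%:Z ->
    pmf_at (Nk y) u = \sum_(j < M) W j y * pmf_at (S j) u.
  move=> y0 uM; have y0' := ltW y0.
  have mN := poisson_process_measurable hN y0'.
  rewrite /pmf_at; set E := [set w | (Nk y w)%:Z = u].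
  have mE : measurable E.
    exact: (measurable_discrete_preimage [set m : nat | m%:Z = u]
             (poisson_order_measurable y0')).
  have term (j : nat) : fine (P (E `&` N y @^-1` [set j])) = W j y * pmf_at (S j) u.
    rewrite (_ : E `&` _ = N y @^-1` [set j] `&` [set w | (S j w)%:Z = u]); last first.
      apply/seteqP; split => w /= [].
        by rewrite /E/= NkE// => + Nj; rewrite Nj.
      by move=> Nj Sj; split => //; rewrite /E/= NkE// Nj.
    rewrite iNX; first last.
    - case: u {uM E mE} => [m|m]; last first.
        rewrite (_ : [set w | _] = set0); last by apply/seteqP; split.
        exact: sigma_algebra0.
      rewrite (_ : [set w | _] = [set w | S j w = m]).
        exact: partial_sum_generated.
      by apply/seteqP; split => w /= => [[]|->].
    - apply: sub_sigma_algebra; exists y => //; exists [set j] => //.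
      by rewrite setTI.
    rewrite fineM ?fin_num_measure//; last 2 first.
    - exact: measurable_discrete_preimage.
    - exact: (measurable_discrete_preimage [set m : nat | m%:Z =
        u] (measurable_partial_sum mX j)).
    congr (_ * _); rewrite /W.
    have -> : N y @^-1` [set j] = [set w | (N y w - N 0%R w)%N = j].
      by apply/seteqP; split => w /=; rewrite (poisson_process0 hN) subn0.
    by rewrite (poisson_process_law hN j (lexx 0) y0) subr0 /poisson_pmf -/c mulr_gt0.
  rewrite (@total_probability_finite _ _ _ P (N y) E M)//.
    by apply: eq_bigr => j _; exact: term.
  move=> j Mj; rewrite term (@uniform_sum_small k X k_gt0 mX uX iX) ?mulr0//.
  by apply: (lt_le_trans uM).
move=> x0; have [M zM] : exists M : nat, z < M%:Z.
  case: z => [m|m]; first by exists m.+1; lia.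
  by exists 0%N.
have near_law : \forall y \near x, \sum_(j < M.+1) W j y * pmf_at (S j) z =
  pmf_at (Nk y) z.
  by apply: filterS (lt_nbhsr x0) => y y0; rewrite -law//; lia.
apply: near_eq_is_derive near_law _.
have dW (j : nat) : is_derive x 1 (W j) (c *
  ((if j is i.+1 then W i x else 0) - W j x)).
  exact: is_derive_poisson_term.
rewrite (_ : (fun y => _) = \sum_(j < M.+1) (pmf_at (S j) z \*: W j)); last first.
  apply/funext => y; rewrite fct_sumE; apply: eq_bigr => j _.
  by rewrite /GRing.scale/= mulrC.
apply: is_derive_eq.
rewrite (law x z M.+1)//; last lia.
(* shifting the index turns a Poisson weight w_(j-1) into one more step *)
transitivity (c * (\sum_(j < M) W j x * pmf_at (S j.+1) z -
                   \sum_(j < M.+1) W j x * pmf_at (S j) z)).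
  rewrite /GRing.scale/= [X in _ = c * (X - _)](_ : _ =
      \sum_(j < M.+1) (if (j : nat) is i.+1 then W i x else 0) * pmf_at (S j) z);
        last first.
    by rewrite big_ord_recl/= mul0r add0r.
  rewrite -sumrB mulr_sumr; apply: eq_bigr => j _.
  by rewrite mulrCA -mulrBl [X in c * X]mulrC.
rewrite mulrBr; congr (_ - _).
under eq_bigr do rewrite (uniform_sum_recurrence k_gt0 mX uX iX) mulrCA mulr_sumr.
have ck : c * k%:R^-1 = lambda by rewrite /c mulrAC mulfV ?mul1r// pnatr_eq0 -lt0n.
rewrite -mulr_sumr exchange_big/= mulrA ck.
congr (_ * _); rewrite !big_nat; apply: eq_bigr => l lk.
by rewrite (law x _ M)//; lia.
Qed.

End poisson_order.
End compound_poisson.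

(** * Evaluating a right-continuous process at an independent time *)

Section eventual_events.
Context {d : measure_display} {T : measurableType d} {R : realType}.
Variable P : probability T R.

(** At each sample point the indicators are eventually constant, hence
    convergent, and they are dominated by 1. *)
Lemma eventual_event_probability (E_ : nat -> set T) (E : set T) :
  (forall n, measurable (E_ n)) ->
  (forall w, \forall n \near \oo, E_ n w <-> E w) ->
  measurable E /\ fine (P (E_ n)) @[n --> \oo] --> fine (P E).
Proof.
move=> mE_ EE; have mE : measurable E.
  have -> : E = \bigcup_N \bigcap_(n in [set n | (N <= n)%N]) E_ n.
    apply/seteqP; split => w.
      move=> Ew; have [N _ HN] := EE w; exists N => // n /= Nn.
      exact/(HN n Nn).
    move=> [N _ HN]; have [M _ HM] := EE w.
    apply/(HM (maxn N M)); first exact: leq_maxr.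
    by apply: HN => /=; exact: leq_maxl.
  apply: bigcup_measurable => N _; apply: bigcap_measurable => //.
  by exists N => /=.
split => //; apply: fine_cvg; rewrite -probability_EFin//.
have PE A : measurable A -> (\int[P]_w (\1_A w)%:E = P A)%E.
  by move=> mA; rewrite integral_indic// setIT.
rewrite -PE//; under eq_fun do rewrite -PE//.
have [] := @dominated_convergence _ _ _ P setT measurableT
  (fun n w => (\1_(E_ n) w)%:E) (fun w => (\1_E w : R)%:E) (cst 1%E).
- by move=> n; apply/measurable_EFinP; exact: measurable_indic.
- by apply/measurable_EFinP; exact: measurable_indic.
- apply: aeW => w _; apply: cvg_near_cst; apply: filterS (EE w) => n EnE.
  by rewrite !indicE; congr ((_ _)%:R%:E); apply/idP/idP; rewrite !inE => /EnE.
- exact: finite_measure_integrable_cst.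
- by apply: aeW => w n _; rewrite lee_fin indicE ger0_norm// lern1 leq_b1.
- by [].
Qed.

End eventual_events.

Section grid.
Context {R : realType}.

(** The j-th grid has mesh 1/(j+1), and a time is rounded to the right end of
    its cell.  The rounded time is strictly larger than the time, which is the
    side on which the paths are continuous. *)
Definition grid_index (j : nat) (x : R) : nat := Num.truncn (j.+1%:R * x).
Definition grid_point (j i : nat) : R := i.+1%:R / j.+1%:R.

Lemma grid_point_gt0 (j i : nat) : 0 < grid_point j i.
Proof. by rewrite divr_gt0. Qed.

Lemma grid_point_itv (j : nat) (x : R) : 0 <= x ->
  x < grid_point j (grid_index j x) <= x + j.+1%:R^-1.
Proof.
move=> x0; have jx0 : 0 <= j.+1%:R * x by rewrite mulr_ge0.
have /andP[l u] := truncn_itv jx0.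
rewrite /grid_point ltr_pdivlMr// mulrC u/= -natr1 mulrDl mul1r lerD2r.
by rewrite ler_pdivrMr// mulrC.
Qed.

Lemma grid_point_right (x : R) (Q : R -> Prop) : 0 <= x ->
  (\forall s \near x^'+, Q s) ->
  \forall j \near \oo, Q (grid_point j (grid_index j x)).
Proof.
move=> x0 [e /= e0 eQ]; near=> j.
have /andP[xs sx] := grid_point_itv j x0.
apply: eQ => //=; rewrite distrC ger0_norm ?subr_ge0 ?(ltW xs)// ltrBlDl.
apply: le_lt_trans sx _; rewrite ltrD2l.
by near: j; exact: near_infty_natSinv_lt (PosNum e0).
Unshelve. all: end_near. Qed.

Lemma measurable_grid_index (j : nat) (D : set R) : measurable D ->
  measurable_fun D (grid_index j).
Proof.
move=> mD; apply: measurable_funTS => _ A _; rewrite setTI.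
pose U (i : nat) := [set x : R | (i < grid_index j x)%N].
have mU i : measurable (U i).
  rewrite (_ : U i = `[i.+1%:R / j.+1%:R, +oo[%classic); first exact: measurable_itv.
  apply/seteqP; split => x; rewrite /U /grid_index/= truncn_gt_nat in_itv/= andbT;
    by rewrite ler_pdivrMr// mulrC.
rewrite (_ : _ @^-1` A =
    \bigcup_(i in A) ((if i is i'.+1 then U i' else setT) `\` U i)); last first.
  apply/seteqP; split => x /=.
    move=> Ax; exists (grid_index j x) => //; split; last by rewrite /U/= ltnn.
    by case E : (grid_index j x) => [|i]//; rewrite /U/= E.
  move=> [i Ai [+ /negP]]; rewrite -leqNgt => Ui iu.
  suff -> : grid_index j x = i by [].
  by apply/eqP; rewrite eqn_leq iu/=; case: i Ui {Ai iu}.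
by apply: bigcup_measurable => i _; apply: measurableD => //; case: i.
Qed.

End grid.

Section subordination.
Context {d : measure_display} {T : measurableType d} {R : realType}.
Variable P : probability T R.
Local Notation mu := (@lebesgue_measure R).
Variables (tau : T -> R) (dens : R -> R) (Z : R -> T -> int).
Hypothesis mtau : measurable_fun setT tau.
Hypothesis tau_ge0 : forall w, 0 <= tau w.
Hypothesis dens_ge0 : forall x : R, 0 < x -> 0 <= dens x.
Hypothesis mdens : measurable_fun (`]0, +oo[ : set R) dens.
Hypothesis tau_law : forall A : set R, measurable A ->
  P (tau @^-1` A) = (\int[mu]_(x in A `&` `]0%R, +oo[) (dens x)%:E)%E.
Hypothesis mZ : forall (x : R) n, 0 <= x -> measurable [set w | Z x w = n].
Hypothesis Z_right_continuous : forall (x : R) w, 0 <= x ->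
  \forall s \near x^'+, Z s w = Z x w.
Hypothesis tau_Z : forall (A : set R) (x : R) n, measurable A -> 0 <= x ->
  P (tau @^-1` A `&` [set w | Z x w = n]) =
  (P (tau @^-1` A) * P [set w | Z x w = n])%E.

Let q (n : int) (x : R) : R := fine (P [set w | Z x w = n]).

Let mpos : measurable (`]0%R, +oo[%classic : set R). Proof. exact: measurable_itv. Qed.

Lemma subordination_density_integrable : mu.-integrable `]0, +oo[ (EFin \o dens).
Proof.
apply/integrableP; split; first exact/measurable_EFinP.
rewrite [ltLHS](_ : _ = (\int[mu]_(x in `]0%R, +oo[) (dens x)%:E)%E); last first.
  by apply: eq_integral => x; rewrite inE/= in_itv/= andbT => x0;
    rewrite ger0_norm// dens_ge0.
by have := tau_law measurableT; rewrite setTI => <-;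
  rewrite preimage_setT probability_setT ltry.
Qed.

Lemma grid_pmf_cvg (n : int) (x : R) : 0 <= x ->
  q n (grid_point j (grid_index j x)) @[j --> \oo] --> q n x.
Proof.
move=> x0; have := @eventual_event_probability _ _ _ P
  (fun j => [set w | Z (grid_point j (grid_index j x)) w = n]) [set w | Z x w = n].
case=> [j|w|//].
  by apply: mZ; rewrite ltW// grid_point_gt0.
have := grid_point_right x0 (Z_right_continuous w x0).
by apply: filterS => j /= ->.
Qed.

Lemma measurable_grid_pmf (j : nat) (n : int) :
  measurable_fun (`]0, +oo[ : set R) (fun x => q n (grid_point j (grid_index j x))).
Proof.
apply: (measurableT_comp (f := fun i => q n (grid_point j i))) => //.
exact: measurable_grid_index.
Qed.

Lemma measurable_subordinated_pmf (n : int) : measurable_fun (`]0, +oo[ : set R) (q n).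
Proof.
apply: (@measurable_fun_cvg _ _ _ _ (fun j x => q n (grid_point j (grid_index j x)))).
  by move=> j; exact: measurable_grid_pmf.
move=> x; rewrite /= in_itv/= andbT => x0; exact: grid_pmf_cvg (ltW x0).
Qed.

(** The rounded time takes countably many values, and on each cell the process
    is observed at one deterministic time, which is independent of tau. *)
Lemma grid_subordination (j : nat) (n : int) :
  let E := [set w | Z (grid_point j (grid_index j (tau w))) w = n] in
  measurable E /\
  P E =
  (\int[mu]_(x in `]0%R, +oo[) (q n (grid_point j (grid_index j x)) * dens x)%:E)%E.
Proof.
move=> E; pose f w := grid_index j (tau w).
pose I (i : nat) : set R := grid_index j @^-1` [set i].
have mI i : measurable (I i).
  by rewrite /I -[_ @^-1` _]setTI; exact: measurable_grid_index.
pose B i := tau @^-1` (I i) `&` [set w | Z (grid_point j i) w = n].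
have mB i : measurable (B i).
  apply: measurableI; first by rewrite -[_ @^-1` _]setTI; exact: mtau.
  by apply: mZ; rewrite ltW// grid_point_gt0.
have UB : \bigcup_i B i = E.
  apply/seteqP; split => w /=.
    by move=> [i _ [/= fi Zi]]; rewrite /E/= fi.
  by move=> Ew; exists (f w).
have tB : trivIset setT B.
  by apply/trivIsetP => i l _ _ /eqP il; apply/seteqP; split => //;
    move=> w [[/= + _] [/= + _]]; rewrite /I/= => -> /il.
have mE : measurable E by rewrite -UB; exact: bigcup_measurable.
split => //; rewrite -UB measure_semi_bigcup//; last by rewrite UB.
pose F i := (`]0%R, +oo[%classic : set R) `&` I i.
have UF : \bigcup_i F i = `]0%R, +oo[%classic.
  by rewrite -setI_bigcupr; apply/setIidPl => x _; exists (grid_index j x).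
have mF i : measurable (F i) by exact: measurableI.
rewrite -UF ge0_integral_bigcup//; last 3 first.
- rewrite UF; apply/measurable_EFinP/measurable_funM => //; exact: measurable_grid_pmf.
- move=> x; rewrite UF/= in_itv/= andbT => x0; rewrite lee_fin mulr_ge0 ?dens_ge0//.
  exact: fine_ge0.
- apply/trivIsetP => i l _ _ /eqP il; apply/seteqP; split => // x [[_ +] [_ +]].
  by rewrite /I/= => -> /il.
apply: eq_eseriesr => i _.
transitivity (P (tau @^-1` I i) * P [set w | Z (grid_point j i) w = n])%E.
  by apply: tau_Z => //; rewrite ltW// grid_point_gt0.
transitivity (\int[mu]_(x in F i) ((q n (grid_point j i))%:E * (dens x)%:E))%E;
  last first.
  by apply: eq_integral => x; rewrite inE => -[_ /= ->]; rewrite EFinM.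
rewrite ge0_integralZl//; last 3 first.
- apply/measurable_EFinP; by apply: measurable_funS mdens => // x [].
- by move=> x []; rewrite /= in_itv/= andbT => x0 _; rewrite lee_fin dens_ge0.
- by rewrite lee_fin fine_ge0.
  rewrite muleC tau_law// [I i `&` _]setIC; congr (_ * _)%E.
  by rewrite -probability_EFin//; apply: mZ; rewrite ltW// grid_point_gt0.
exact: mF.
Qed.

(** By right-continuity of the path, rounding the time on a fine enough grid
    does not change whether a given sample point lies in the event; on the
    other side the mass function is right-continuous and bounded by 1. *)
Lemma subordination_pmf (n : int) :
  measurable [set w | Z (tau w) w = n] /\
  fine (P [set w | Z (tau w) w = n]) = \int[mu]_(x in `]0, +oo[) (q n x * dens x).
Proof.
have [|w|mE cE] := @eventual_event_probability _ _ _ P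
  (fun j => [set w | Z (grid_point j (grid_index j (tau w))) w = n])
  [set w | Z (tau w) w = n].
- by move=> j; have [] := grid_subordination j n.
- have := grid_point_right (tau_ge0 w) (Z_right_continuous w (tau_ge0 w)).
  by apply: filterS => j /= ->.
split => //; rewrite -[LHS](cvg_lim _ cE)//; apply: cvg_lim => //.
have [] := @Rintegral_dominated_cvg _ _ _ mu `]0, +oo[%classic
  (fun j x => q n (grid_point j (grid_index j x)) * dens x)
  (fun x => q n x * dens x) dens mpos.
- by move=> j; apply: measurable_funM => //; exact: measurable_grid_pmf.
- move=> x; rewrite /= in_itv/= andbT => x0.
  by apply: cvgMl; exact: grid_pmf_cvg (ltW x0).
- exact: subordination_density_integrable.
- move=> j x; rewrite /= in_itv/= andbT => x0.
  rewrite ger0_norm ?mulr_ge0 ?dens_ge0 ?fine_ge0//.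
  rewrite -[leRHS]mul1r ler_wpM2r ?dens_ge0// fine_probability_le1//.
  by apply: mZ; rewrite ltW// grid_point_gt0.
move=> _; rewrite [X in X @ _ --> _ -> _](_ : _ = fun j =>
    fine (P [set w | Z (grid_point j (grid_index j (tau w))) w = n]))//.
by apply/funext => j; rewrite /Rintegral; have [_ ->] := grid_subordination j n.
Qed.

End subordination.

(** * The Skellam process of order k *)

Section skellam.
Context {d : measure_display} {T : measurableType d} {R : realType}.
Variable P : probability T R.
Variables (k : nat) (lambda1 lambda2 : R) (N1 N2 : R -> T -> nat) (S : R -> T -> int).
Hypothesis hN1 : poisson_process_order P k lambda1 N1.
Hypothesis hN2 : poisson_process_order P k lambda2 N2.
Hypothesis N1_N2 : independent_processes P N1 N2.
Hypothesis SE : forall (t : R) w, 0 <= t -> S t w = (N1 t w)%:Z - (N2 t w)%:Z.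

Let a (z : int) (x : R) : R := pmf_at P (N1 x) z.
Let b (z : int) (x : R) : R := pmf_at P (N2 x) z.
Let q (n : int) (x : R) : R := fine (P [set w | S x w = n]).

(** By the independence of N1 and N2 this is Pr{S(x) = n, N2(x) < M}.  The
    truncation leaves a finite sum, which can be differentiated term by term. *)
Definition skellam_partial_pmf (M : nat) (n : int) (x : R) : R :=
  \sum_(m < M) a (n + m%:Z) x * b m%:Z x.

(** The operator of the forward equation: mass arrives from n - l by a jump of
    N1 and from n + l by a jump of N2. *)
Definition skellam_generator (f : int -> R -> R) (n : int) (x : R) : R :=
  lambda1 * (\sum_(1 <= l < k.+1) f (n - l%:Z) x) +
  lambda2 * (\sum_(1 <= l < k.+1) f (n + l%:Z) x) -
  k%:R * (lambda1 + lambda2) * f n x.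

Lemma skellam_measurable (x : R) (n : int) : 0 <= x -> measurable [set w | S x w = n].
Proof.
move=> x0; have m1 := poisson_order_measurable hN1 x0;
  have m2 := poisson_order_measurable hN2 x0.
rewrite (_ : [set w | _] = \bigcup_m (N2 x @^-1` [set m] `&`
  N1 x @^-1` [set i : nat | i%:Z = n + m%:Z])).
  by apply: bigcupT_measurable => m; apply: measurableI;
    exact: measurable_discrete_preimage.
apply/seteqP; split => w /=; first by rewrite SE// => Sn; exists (N2 x w) => //;
  split => //=; lia.
by move=> [m _ [/= m2w m1w]]; rewrite SE// m2w m1w; lia.
Qed.

Lemma skellam_right_continuous (x : R) w : 0 <= x ->
  \forall s \near x^'+, S s w = S x w.
Proof.
move=> x0; have r1 := poisson_order_right_continuous hN1 w x0.
have r2 := poisson_order_right_continuous hN2 w x0.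
near=> s; rewrite !SE//; last by apply: ltW; apply: le_lt_trans x0 _; near: s;
  exact: nbhs_right_gt.
by rewrite (near r1 s)// (near r2 s).
Unshelve. all: end_near. Qed.

Lemma skellam_partial_pmf_cvg (n : int) (x : R) : 0 <= x ->
  skellam_partial_pmf M n x @[M --> \oo] --> q n x.
Proof.
move=> x0; have m1 := poisson_order_measurable hN1 x0;
  have m2 := poisson_order_measurable hN2 x0.
have := total_probability_cvg (P := P) m2 (skellam_measurable n x0).
rewrite (_ : (fun M => _) = skellam_partial_pmf ^~ n ^~ x)//.
apply/funext => M; apply: eq_bigr => m _.
rewrite (_ : _ `&` _ = N1 x @^-1` [set i : nat | i%:Z = n + (m : nat)%:Z] `&`
  N2 x @^-1` [set (m : nat)]).
  rewrite N1_N2; first last.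
  - by apply: sub_sigma_algebra; exists x => //; exists [set (m : nat)] => //;
      rewrite setTI.
  - by apply: sub_sigma_algebra; exists x => //; eexists; last by rewrite setTI.
  rewrite fineM ?fin_num_measure//; [|exact: measurable_discrete_preimage..].
  by rewrite /a /b pmf_at_nat.
by apply/seteqP; split => w /= [+ N2w]; rewrite SE// N2w => N1w; split => //=; lia.
Qed.

Lemma skellam_partial_pmf_ge0 (M : nat) (n : int) (x : R) :
  0 <= skellam_partial_pmf M n x.
Proof. by apply: sumr_ge0 => m _; rewrite mulr_ge0// pmf_at_ge0. Qed.

Lemma skellam_partial_pmf_le1 (M : nat) (n : int) (x : R) : 0 <= x ->
  skellam_partial_pmf M n x <= 1.
Proof.
move=> x0; have c := @skellam_partial_pmf_cvg n x x0.
apply: le_trans (fine_probability_le1 P (skellam_measurable n x0)).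
rewrite -[leRHS](cvg_lim _ c)//;
  apply: (nondecreasing_cvgn_le (u_ := fun M => skellam_partial_pmf M n x)).
  apply/nondecreasing_seqP => m; rewrite /skellam_partial_pmf big_ord_recr/= lerDl.
  by rewrite mulr_ge0// pmf_at_ge0.
by apply/cvg_ex; exists (q n x).
Qed.

(** A jump of N2 by l moves the truncation level together with the place. *)
Lemma skellam_partial_shift (M l : nat) (n : int) (x : R) :
  \sum_(m < M) a (n + m%:Z) x * b (m%:Z - l%:Z) x =
    skellam_partial_pmf (M - l) (n + l%:Z) x.
Proof.
have b0 (m : nat) : (m < l)%N -> b (m%:Z - l%:Z) x = 0.
  by move=> ml; rewrite /b pmf_at_neg//; lia.
have [Ml|lM] := leqP M l.
  rewrite (_ : (M - l)%N = 0%N); last lia.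
  rewrite /skellam_partial_pmf big_ord0 big1// => m _; rewrite b0 ?mulr0//.
  by have := ltn_ord m; lia.
have [L ->] : exists L, M = (l + L)%N by exists (M - l)%N; lia.
rewrite addKn big_split_ord/= big1 ?add0r; last first.
  by move=> m _; rewrite b0 ?mulr0//; have := ltn_ord m; lia.
apply: eq_bigr => m _; congr (a _ _ * b _ _); lia.
Qed.

(** The derivative of the truncated mass.  The truncation level drops in the
    middle sum only, so this is not the generator applied to a truncated mass
    function, but the difference disappears as M grows. *)
Definition skellam_partial_derivative (M : nat) (n : int) (x : R) : R :=
  lambda1 * (\sum_(1 <= l < k.+1) skellam_partial_pmf M (n - l%:Z) x) +
  lambda2 * (\sum_(1 <= l < k.+1) skellam_partial_pmf (M - l) (n + l%:Z) x) -
  k%:R * (lambda1 + lambda2) * skellam_partial_pmf M n x.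

Lemma skellam_partial_derivative_cvg (n : int) (x : R) : 0 <= x ->
  skellam_partial_derivative M n x @[M --> \oo] --> skellam_generator q n x.
Proof.
move=> x0.
have cs (G : nat -> int) :
    (\sum_(1 <= l < k.+1) skellam_partial_pmf M (G l) x) @[M --> \oo] -->
     \sum_(1 <= l < k.+1) q (G l) x.
  by apply: (cvg_big add_continuous) => l _; exact: skellam_partial_pmf_cvg.
have cs' (G : nat -> int) :
    (\sum_(1 <= l < k.+1) skellam_partial_pmf (M - l)%N (G l) x) @[M --> \oo] -->
     \sum_(1 <= l < k.+1) q (G l) x.
  apply: (cvg_big add_continuous) => l _.
  exact: (cvg_comp _ _ (@cvg_subnr l) (@skellam_partial_pmf_cvg (G l) x x0)).
apply: cvgB; last by apply: cvgMr; exact: skellam_partial_pmf_cvg.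
by apply: cvgD; apply: cvgMr; [exact: cs|exact: cs'].
Qed.

Hypotheses (k_gt0 : (1 <= k)%N) (lambda1_gt0 : 0 < lambda1) (lambda2_gt0 : 0 < lambda2).

Lemma is_derive_skellam_partial_pmf (M : nat) (n : int) (x : R) : 0 < x ->
  is_derive x 1 (skellam_partial_pmf M n) (skellam_partial_derivative M n x).
Proof.
move=> x0.
have da z : is_derive x 1 (a z) _ :=
  poisson_order_kolmogorov k_gt0 lambda1_gt0 hN1 z x0.
have db z : is_derive x 1 (b z) _ :=
  poisson_order_kolmogorov k_gt0 lambda2_gt0 hN2 z x0.
rewrite (_ : skellam_partial_pmf M n = \sum_(m < M) (a (n + m%:Z) * b m%:Z));
  last first.
  by apply/funext => y; rewrite fct_sumE.
apply: is_derive_eq; rewrite /GRing.scale/= /skellam_partial_derivative.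
under [X in _ = _ + _ * X - _]eq_bigr do rewrite -skellam_partial_shift.
rewrite [X in _ = _ * X + _ - _]exchange_big [X in _ = _ + _ * X - _]exchange_big/=.
rewrite /skellam_partial_pmf !mulr_sumr -big_split -sumrB/=; apply: eq_bigr => m _.
rewrite -/(a _ _) -/(b _ _).
under [X in _ = _ * X + _ - _]eq_bigr do rewrite addrAC.
by rewrite -!(mulr_suml, mulr_sumr); ring.
Qed.

(** A bound independent of M, which provides the majorant when M tends to
    infinity. *)
Lemma skellam_partial_derivative_bound (M : nat) (n : int) (x : R) : 0 < x ->
  `|skellam_partial_derivative M n x| <= 2 * (k%:R * (lambda1 + lambda2)).
Proof.
move=> /ltW x0.
have sum_bound (F : nat -> nat) (G : nat -> int) :
    0 <= \sum_(1 <= l < k.+1) skellam_partial_pmf (F l) (G l) x <= k%:R.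
  rewrite sumr_ge0 => [|l _]; last exact: skellam_partial_pmf_ge0.
  rewrite -[leRHS](_ : \sum_(1 <= l < k.+1) 1 = _);
    last by rewrite sumr_const_nat subn1.
  by apply: ler_sum => l _; exact: skellam_partial_pmf_le1.
rewrite /skellam_partial_derivative.
have /andP[s0 sk] := sum_bound (fun=> M) (fun l => n - l%:Z).
have /andP[r0 rk] := sum_bound (fun l => M - l)%N (fun l => n + l%:Z).
have p0 := skellam_partial_pmf_ge0 M n x; have p1 := @skellam_partial_pmf_le1 M n x x0.
set s := \sum_(_ <= _ < _) _ in s0 sk *; set r := \sum_(_ <= _ < _) _ in r0 rk *.
set p := skellam_partial_pmf M n x in p0 p1 *.
have l1 := ltW lambda1_gt0; have l2 := ltW lambda2_gt0.
have h1 : 0 <= lambda1 * s <= lambda1 * k%:R by rewrite mulr_ge0//= ler_wpM2l.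
have h2 : 0 <= lambda2 * r <= lambda2 * k%:R by rewrite mulr_ge0//= ler_wpM2l.
have h3 : 0 <= k%:R * (lambda1 + lambda2) * p <= k%:R * (lambda1 + lambda2).
  by rewrite !mulr_ge0 ?addr_ge0//= ler_piMr// mulr_ge0// addr_ge0.
rewrite ler_norml; lra.
Qed.

Lemma continuous_skellam_partial_derivative (M : nat) (n : int) (x : R) : 0 < x ->
  {for x, continuous (skellam_partial_derivative M n)}.
Proof.
move=> x0; have c L m : {for x, continuous (skellam_partial_pmf L m)}.
  exact: is_derive_continuous (is_derive_skellam_partial_pmf L m x0).
have cs (F : nat -> nat) (G : nat -> int) :
    {for x, continuous (fun y =>
      \sum_(1 <= l < k.+1) skellam_partial_pmf (F l) (G l) y)}.
  by apply: (cvg_big add_continuous) => l _; exact: c.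
apply: continuousB; last by apply: continuousM; [exact: cst_continuous|exact: c].
apply: continuousD; apply: continuousM; try exact: cst_continuous.
  exact: (cs (fun=> M) (fun l => n - l%:Z)).
exact: (cs (fun l => M - l)%N (fun l => n + l%:Z)).
Qed.

End skellam.

(** * The inverse Gaussian subordination of the Skellam process *)

Section subordinated_skellam.
Context {d : measure_display} {T : measurableType d} {R : realType}.
Variable P : probability T R.
Variables (k : nat) (lambda1 lambda2 delta gamma : R).
Variables (S : R -> T -> int) (Y : R -> T -> R).
Hypotheses (k_gt0 : (1 <= k)%N) (lambda1_gt0 : 0 < lambda1) (lambda2_gt0 : 0 < lambda2).
Hypotheses (delta_gt0 : 0 < delta) (gamma_gt0 : 0 < gamma).
Hypothesis hS : skellam_process_order P k lambda1 lambda2 S.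
Hypothesis hY : ig_subordinator P delta gamma Y.
Hypothesis hYS : independent_processes P Y S.

Local Notation mu := (@lebesgue_measure R).
Local Notation pos := (`]0%R, +oo[%classic : set R).
Local Notation g := (ig_density delta gamma).
Local Notation g_t := (ig_dt delta gamma).
Local Notation g_tt := (ig_dtt delta gamma).
Local Notation g_x := (ig_dx delta gamma).
Let q (n : int) (x : R) : R := fine (P [set w | S x w = n]).
Let p : int -> R -> R := subordinated_pmf P S Y.

Lemma ig_subordinator_ge0 (t : R) w : 0 <= t -> 0 <= Y t w.
Proof.
move=> t0; have hs := ig_subordinator_subordinator hY.
by rewrite -(subordinator0 hs w) (subordinator_nondecreasing hs).
Qed.

Lemma measurable_ig_density (t : R) : 0 < t -> measurable_fun pos (g ^~ t).
Proof. by move=> t0; apply: continuous_pos_measurable => x x0;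
  exact: continuous_ig_density. Qed.

Lemma ig_density_integrable (t : R) : 0 < t -> mu.-integrable pos (EFin \o g ^~ t).
Proof.
move=> t0; apply: (subordination_density_integrable (P := P) (tau := Y t)).
- by move=> x x0; exact/ltW/ig_density_gt0.
- exact: measurable_ig_density.
- by move=> A mA; exact: (ig_subordinator_density hY).
Qed.

Let mS (x : R) (n : int) : 0 <= x -> measurable [set w | S x w = n].
Proof. by have [N1 [N2 [h1 h2 _ SE]]] := hS;
  exact: skellam_measurable h1 h2 SE x n. Qed.

Let S_right (x : R) w : 0 <= x -> \forall s \near x^'+, S s w = S x w.
Proof. by have [N1 [N2 [h1 h2 _ SE]]] := hS;
  exact: skellam_right_continuous h1 h2 SE x w. Qed.

Lemma skellam_pmf_norm_le1 (n : int) (x : R) : 0 < x -> `|q n x| <= 1.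
Proof. by move=> /ltW x0; rewrite ger0_norm ?fine_ge0// fine_probability_le1//;
  exact: mS. Qed.

Lemma skellam_pmf_measurable (n : int) : measurable_fun pos (q n).
Proof. exact: (measurable_subordinated_pmf P mS S_right). Qed.

Lemma subordinated_pmf_integral (n : int) (t : R) : 0 < t ->
  p n t = \int[mu]_(x in pos) (q n x * g x t).
Proof.
move=> t0; rewrite /p /subordinated_pmf.
have [] := @subordination_pmf _ _ _ P (Y t) (g ^~ t) S _ _ _ _ _ _ _ _ n => //.
- exact: (subordinator_measurable (ig_subordinator_subordinator hY) (ltW t0)).
- by move=> w; exact: ig_subordinator_ge0 (ltW t0).
- by move=> x x0; exact/ltW/ig_density_gt0.
- exact: measurable_ig_density.
- by move=> A mA; exact: (ig_subordinator_density hY).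
- move=> A x m mA x0; apply: hYS; apply: sub_sigma_algebra.
    by exists t; [exact: ltW|exists A => //; rewrite setTI].
  by exists x => //; exists [set m] => //; rewrite setTI.
Qed.

Let iqg (n : int) (t : R) : 0 < t ->
  mu.-integrable pos (EFin \o (fun x => q n x * g x t)).
Proof.
by move=> /(ig_weighted_derivatives_integrable delta_gt0 gamma_gt0 ig_density_integrable
  (skellam_pmf_measurable n) (@skellam_pmf_norm_le1 n))[].
Qed.

(** The truncated masses are integrated by parts, and both sides converge as
    the truncation is removed: the left side is dominated by a majorant of
    g_x, the right side by a multiple of g. *)
Lemma skellam_generator_by_parts (n : int) (t : R) : 0 < t ->
  \int[mu]_(x in pos) (q n x * g_x x t) =
  - \int[mu]_(x in pos) (skellam_generator k lambda1 lambda2 q n x * g x t).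
Proof.
move=> t0; have [N1 [N2 [h1 h2 h12 SE]]] := hS.
have t40 : 0 < t / 2 / 2 by rewrite !divr_gt0.
have [K hK] := ig_derivatives_dominated_at delta_gt0 gamma_gt0 t0.
have tt : t / 2 < t < t * 2 by lra.
have {}hK (x : R) x0 := hK x t x0 tt.
pose r M := skellam_partial_pmf P N1 N2 M n.
pose r' M := skellam_partial_derivative P k lambda1 lambda2 N1 N2 M n.
pose C := 2 * (k%:R * (lambda1 + lambda2)).
have dr M (x : R) : 0 < x -> is_derive x 1 (r M) (r' M x).
  by move=> x0; exact: (is_derive_skellam_partial_pmf h1 h2 k_gt0 lambda1_gt0
    lambda2_gt0).
have cr' M (x : R) : 0 < x -> {for x, continuous (r' M)}.
  by move=> x0; exact: (continuous_skellam_partial_derivative h1 h2 k_gt0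
    lambda1_gt0 lambda2_gt0).
have r1 M (x : R) : 0 < x -> `|r M x| <= 1.
  move=> x0; rewrite ger0_norm ?skellam_partial_pmf_ge0//.
  exact: (skellam_partial_pmf_le1 h1 h2 h12 SE M n (ltW x0)).
have r'C M (x : R) : 0 < x -> `|r' M x| <= C.
  by move=> x0; exact: (skellam_partial_derivative_bound h1 h2 h12 SE).
have parts M := Rintegral_by_parts delta_gt0 gamma_gt0 ig_density_integrable t0
  (dr M) (cr' M) (r1 M) (r'C M).
have cr M (x : R) : 0 < x -> {for x, continuous (r M)}.
  by move=> x0; exact: is_derive_continuous (dr M x x0).
have iscale (c s : R) : 0 < s -> mu.-integrable pos (EFin \o (fun x => c * g x s)).
  by move=> s0; apply: integrable_scale;
    [exact: measurable_itv|exact: ig_density_integrable].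
have g0 (x : R) : 0 < x -> `|g x t| = g x t.
  by move=> x0; rewrite ger0_norm// ltW// ig_density_gt0.
have lim_left : (\int[mu]_(x in pos) (r M x * g_x x t)) @[M --> \oo] -->
    \int[mu]_(x in pos) (q n x * g_x x t).
  have [|M|x /posP x0||M x /posP x0|] := @Rintegral_dominated_cvg _ _ _ mu pos
    (fun M x => r M x * g_x x t) (fun x => q n x * g_x x t) (fun x => K *
      g x (t / 2 / 2)).
  - exact: measurable_itv.
  - apply: continuous_pos_measurable => x x0.
    by apply: continuousM; [exact: cr|exact: continuous_ig_dx].
  - by apply: cvgMl; exact: (skellam_partial_pmf_cvg h1 h2 h12 SE (ltW x0)).
  - exact: iscale.
  - by rewrite normrM; have [_ _ _] := hK x x0; apply: le_trans; rewrite ler_piMl// r1.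
  - by [].
have lim_right : (\int[mu]_(x in pos) (r' M x * g x t)) @[M --> \oo] -->
    \int[mu]_(x in pos) (skellam_generator k lambda1 lambda2 q n x * g x t).
  have [|M|x /posP x0||M x /posP x0|] := @Rintegral_dominated_cvg _ _ _ mu pos
    (fun M x => r' M x * g x t)
    (fun x => skellam_generator k lambda1 lambda2 q n x * g x t) (fun x => C * g x t).
  - exact: measurable_itv.
  - apply: continuous_pos_measurable => x x0.
    by apply: continuousM; [exact: cr'|exact: continuous_ig_density].
  - apply: cvgMl.
    exact: (skellam_partial_derivative_cvg h1 h2 h12 SE (ltW x0)).
  - exact: iscale.
  - by rewrite normrM g0// ler_wpM2r ?r'C// ltW// ig_density_gt0.
  - by [].
rewrite -[LHS](cvg_lim _ lim_left)//; apply: cvg_lim => //.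
rewrite (_ : (fun M => _) = (fun M => - \int[mu]_(x in pos) (r' M x * g x t)));
  last by apply/funext.
exact: cvgN.
Qed.

Lemma skellam_generator_integral (n : int) (t : R) : 0 < t ->
  \int[mu]_(x in pos) (skellam_generator k lambda1 lambda2 q n x * g x t) =
  skellam_generator k lambda1 lambda2 p n t.
Proof.
move=> t0; pose F z x := q z x * g x t.
have sumF (G : nat -> int) :=
  @Rintegral_sum _ _ _ mu pos (measurable_itv _) _ (index_iota 1 k.+1)
  (fun l => F (G l)) (fun l => iqg (G l) t0).
have [im sm] := sumF (fun l => n - l%:Z); have [ip sp] := sumF (fun l => n + l%:Z).
rewrite /skellam_generator subordinated_pmf_integral//.
under eq_bigr do rewrite subordinated_pmf_integral//.
under [X in _ = _ + _ * X - _]eq_bigr do rewrite subordinated_pmf_integral//.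
rewrite -sm -sp.
have iZ := @integrable_scale _ _ _ mu pos (measurable_itv _).
have iF := iqg n t0.
pose c := k%:R * (lambda1 + lambda2).
transitivity (\int[mu]_(x in pos)
  (lambda1 * (\sum_(1 <= l < k.+1) F (n - l%:Z) x) +
   (lambda2 * (\sum_(1 <= l < k.+1) F (n + l%:Z) x) + - c * F n x))).
  apply: eq_Rintegral => x _; rewrite /skellam_generator /F -!mulr_suml -/c; ring.
rewrite RintegralD; [|exact: measurable_itv|exact: iZ|]; last first.
  by apply: (@integrable_add _ _ _ mu pos (measurable_itv _)); exact: iZ.
rewrite RintegralD; [|exact: measurable_itv|exact: iZ|exact: iZ].
rewrite !RintegralZl//; [|exact: measurable_itv..].
by rewrite addrA mulNr.
Qed.

End subordinated_skellam.

Theorem proposition3p2 (d : measure_display) (T : measurableType d)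
    (R : realType) (P : probability T R)
    (k : nat) (lambda1 lambda2 delta gamma : R)
    (S : R -> T -> int) (Y : R -> T -> R)
    (hk : (1 <= k)%N) (hlambda1 : 0 < lambda1) (hlambda2 : 0 < lambda2)
    (hdelta : 0 < delta) (hgamma : 0 < gamma)
    (hS : skellam_process_order P k lambda1 lambda2 S)
    (hY : ig_subordinator P delta gamma Y)
    (hYS : independent_processes P Y S) :
  let p : int -> R -> R := subordinated_pmf P S Y in
  forall (n : int) (t : R), 0 < t ->
    [/\ derivable (p n) t 1,
        derivable (derive1 (p n)) t 1 &
        derive1n 2 (p n) t - 2 * delta * gamma * derive1 (p n) t =
        2 * delta ^+ 2 *
          (k%:R * (lambda1 + lambda2) * p n t
           - lambda1 * (\sum_(1 <= j < k.+1) p (n - j%:Z) t)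
           - lambda2 * (\sum_(1 <= j < k.+1) p (n + j%:Z) t))].
Proof.
move=> p n t t0; pose q (m : int) (x : R) : R := fine (P [set w | S x w = m]).
pose mu := @lebesgue_measure R; pose pos := (`]0%R, +oo[%classic : set R).
have ig_int := ig_density_integrable hdelta hY.
have mq : measurable_fun pos (q n) := skellam_pmf_measurable hS n.
have q1 (x : R) : 0 < x -> `|q n x| <= 1 :=
  @skellam_pmf_norm_le1 _ _ _ _ _ _ _ _ hS n x.
have near_pos (s : R) (Q : R -> Prop) : 0 < s -> (forall r : R, 0 < r -> Q r) ->
  \near s, Q s.
  by move=> s0 HQ; apply: filterS (lt_nbhsr s0) => r; exact: HQ.
pose I1 (s : R) := \int[mu]_(x in pos) (q n x * ig_dt delta gamma x s).
pose I2 (s : R) := \int[mu]_(x in pos) (q n x * ig_dtt delta gamma x s).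
have dp (s : R) : 0 < s -> is_derive s 1 (p n) (I1 s).
  move=> s0; have [H _] := ig_weighted_derivatives hdelta hgamma ig_int mq q1 s0.
  apply: near_eq_is_derive H; apply: near_pos s0 _ => r r0.
  by rewrite /p (subordinated_pmf_integral hdelta hS hY hYS).
have p'E (s : R) : 0 < s -> derive1 (p n) s = I1 s.
  by move=> s0; rewrite derive1E; have [] := dp _ s0.
have dp' (s : R) : 0 < s -> is_derive s 1 (derive1 (p n)) (I2 s).
  move=> s0; have [_ H] := ig_weighted_derivatives hdelta hgamma ig_int mq q1 s0.
  by apply: near_eq_is_derive H; apply: near_pos s0 _ => r r0; rewrite p'E.
split; [by have [] := dp _ t0|by have [] := dp' _ t0|].
rewrite p'E// [derive1n 2 _ _](_ : _ = I2 t); last first.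
  by rewrite /= derive1E; have [] := dp' _ t0.
rewrite (ig_weighted_pde hdelta hgamma ig_int mq q1 t0).
rewrite (skellam_generator_by_parts hk hlambda1 hlambda2 hdelta hgamma hS hY n t0).
rewrite (skellam_generator_integral hdelta hgamma hS hY hYS n t0)
  /skellam_generator -/p.
ring.
Qed.
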